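(* Let $n\geq 2$, $h\geq 1$ and $i$ be integers such that $\mathcal{F}_h^{i}(n-1,n)$ is non-empty. If $n\neq 2$, then the fundamental group of the $i$th ordered configuration space of hyperplane arrangements $\mathcal{F}_h^{i}(n-1,n)$ is trivial. If $n=2$, then the fundamental group of $\mathcal{F}_h^{i}(n-1,n)$ is isomorphic to the pure braid group on $h$ strings of the sphere, $\pi_1(\mathcal{F}_h(\mathbb{C}\mathbb{P}^1))$.
   Context: $Gr(n-1,n)$ is the complex Grassmannian manifold parametrizing the $(n-1)$-dimensional linear subspaces (hyperplanes) of $\mathbb{C}^n$. For a manifold $M$, $\mathcal{F}_h(M)=\{(x_1,\ldots,x_h)\in M^h\mid x_a\neq x_b \text{ for } a\neq b\}$ is the ordered configuration space of $h$ distinct points in $M$, and the pure braid group on $h$ strings of $M$ is $\pi_1(\mathcal{F}_h(M))$. The $i$th ordered configuration space of hyperplane arrangements is $$\mathcal{F}_h^i(n-1,n)=\{(H_1,\ldots,H_h)\in\mathcal{F}_h(Gr(n-1,n))\mid \dim(H_1+\cdots+H_h)=i\},$$ topologized as a subspace of $Gr(n-1,n)^h$. *)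

(* Defs.v *)
From HB Require Import structures.
From mathcomp Require Import all_boot all_order all_algebra generic_quotient.
From mathcomp Require Import complex.
From mathcomp Require Import all_classical reals topology normedtype homotopy.
From mathcomp Require Import ring lra.

Set Implicit Arguments.
Unset Strict Implicit.
Unset Printing Implicit Defensive.

Import Order.TTheory GRing.Theory Num.Theory.
Import numFieldTopology.Exports numFieldNormedType.Exports.

Local Open Scope classical_set_scope.
Local Open Scope ring_scope.
Local Open Scope quotient_scope.

Section UnitInterval.
Context {R : realType}.

Definition unitI : Type := set_type `[0 : R, 1]%classic.
HB.instance Definition _ := Topological.on unitI.

Definition ival (s : unitI) : R := \val s.

Lemma clampI_subproof (t : R) :
  Order.max 0 (Order.min t 1) \in `[0 : R, 1]%classic.
Proof.
by rewrite inE/= in_itv/= le_max lexx ge_max ler01 ge_min lexx orbT.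
Qed.

Definition clampI (t : R) : unitI :=
  exist (fun u => u \in `[0 : R, 1]%classic) _ (clampI_subproof t).

Lemma unitI_ge0 (s : unitI) : 0 <= ival s.
Proof. by rewrite /ival; case: s => s /= /set_mem; rewrite /= in_itv/= => /andP[]. Qed.

Lemma unitI_le1 (s : unitI) : ival s <= 1.
Proof. by rewrite /ival; case: s => s /= /set_mem; rewrite /= in_itv/= => /andP[]. Qed.

Lemma clampIK : cancel ival clampI.
Proof.
move=> s; apply: val_inj; rewrite /= -/(ival s).
by rewrite (min_idPl (unitI_le1 s)) (max_idPr (unitI_ge0 s)).
Qed.

Lemma val_clampI (t : R) : 0 <= t <= 1 -> ival (clampI t) = t.
Proof. by move=> /andP[t0 t1]; rewrite /ival /= (min_idPl t1) (max_idPr t0). Qed.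

Lemma unitI_neq : clampI 0 != clampI 1.
Proof.
apply/eqP => /(congr1 ival).
by rewrite !val_clampI ?lexx ?ler01// => /esym/eqP; rewrite oner_eq0.
Qed.

HB.instance Definition _ := isBiPointed.Build unitI unitI_neq.

Lemma val_zero : ival (zero : unitI) = 0.
Proof. by rewrite val_clampI ?lexx ?ler01. Qed.

Lemma val_one : ival (one : unitI) = 1.
Proof. by rewrite val_clampI ?lexx ?ler01. Qed.

End UnitInterval.
Arguments unitI R : clear implicits.
#[global] Arguments ival : simpl never.
#[global] Arguments clampI : simpl never.

Section Continuity.
Context {R : realType}.
Implicit Types X T : topologicalType.

Lemma val_unitI_continuous : continuous (fun s : unitI R => ival s).
Proof. exact: initial_continuous. Qed.

Lemma clampI_continuous : continuous (@clampI R).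
Proof.
apply/continuous_comp_initial.
have -> : set_val \o @clampI R = (fun t : R => Order.max 0 (Order.min t 1)).
  exact/funext.
move=> t; apply: (@continuous_max R R (cst 0) (fun t : R => Order.min t 1)).
  exact: cvg_cst.
by apply: (@continuous_min R R id (cst 1)); [exact: cvg_id | exact: cvg_cst].
Qed.

Lemma clamp_comp_continuous X (g : X -> R) :
  continuous g -> continuous (fun x => clampI (g x)).
Proof.
move=> cg x; apply: (@continuous_comp _ _ _ g clampI); first exact: cg.
exact: clampI_continuous.
Qed.

Lemma glue_continuous X T (g : X -> R) (c : R) (F G : X -> T) :
  continuous g -> continuous F -> continuous G ->
  (forall x, g x = c -> F x = G x) ->
  continuous (fun x => if g x <= c then F x else G x).
Proof.
move=> cg cF cG FG x A /= nA0.
suff : \forall y \near x, A (if g y <= c then F y else G y) by [].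
move: nA0; have [gc|gc|gc] := ltgtP (g x) c.
- move=> /cF nA; near=> y => /=.
  have -> : g y <= c.
    apply/ltW; near: y; apply: (cg x [set r | r < c]).
    by apply: open_nbhs_nbhs; split => //; exact: open_lt.
  near: y; exact: nA.
- move=> /cG nA; near=> y => /=.
  have gy : c < g y.
    near: y; apply: (cg x [set r | c < r]).
    by apply: open_nbhs_nbhs; split => //; exact: open_gt.
  rewrite leNgt gy /=; near: y; exact: nA.
- move=> /= nA; have nA' := nA; rewrite (FG _ gc) in nA'.
  near=> y => /=; case: ifP => _; near: y; [exact: cF|exact: cG].
Unshelve. all: by end_near. Qed.

Lemma val_continuous_comp X (f : X -> unitI R) :
  continuous f -> continuous (fun x => ival (f x)).
Proof.
move=> cf x; apply: (@continuous_comp _ _ _ f (fun s : unitI R => ival s)).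
  exact: cf.
exact: val_unitI_continuous.
Qed.

End Continuity.

Section PathAlgebra.
Context {R : realType} {T : topologicalType}.
Implicit Types x y z w : T.

Local Notation path x y := {path (unitI R) from x to y in T}.

Lemma path_continuous x y (p : path x y) : continuous p.
Proof. exact: cts_fun. Qed.

Lemma path_comp_continuous (X : topologicalType) x y (p : path x y)
  (f : X -> unitI R) : continuous f -> continuous (fun s => p (f s)).
Proof.
by move=> cf s; apply: (@continuous_comp _ _ _ f p); [exact: cf|exact: path_continuous].
Qed.

Definition cat_fun x y z (p : path x y) (q : path y z) (s : unitI R) : T :=
  if ival s <= 2^-1 then p (clampI (2 * ival s))
  else q (clampI (2 * ival s - 1)).

Lemma lin_continuous (X : topologicalType) (f : X -> R) (a b : R) :
  continuous f -> continuous (fun s => a * f s + b).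
Proof.
move=> cf s; apply: cvgD; last exact: cvg_cst.
by apply: cvgM; [exact: cvg_cst|exact: cf].
Qed.

Lemma half_continuous (X : topologicalType) (f : X -> R) :
  continuous f -> continuous (fun s => clampI (2 * f s)).
Proof.
move=> cf; apply: clamp_comp_continuous.
by move=> s; apply: cvgM; [exact: cvg_cst|exact: cf].
Qed.

Lemma half2_continuous (X : topologicalType) (f : X -> R) :
  continuous f -> continuous (fun s => clampI (2 * f s - 1)).
Proof. by move=> cf; apply: clamp_comp_continuous; exact: lin_continuous. Qed.

Lemma clampI_le0 (t : R) : t <= 0 -> clampI t = zero.
Proof.
move=> t0; apply: val_inj; rewrite -[RHS]/(ival zero) val_zero /=.
by apply: max_idPl; rewrite ge_min t0.
Qed.

Lemma clampI_ge1 (t : R) : 1 <= t -> clampI t = one.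
Proof.
by move=> t1; apply: val_inj; rewrite -[RHS]/(ival one) val_one /= (min_idPr t1); apply: max_idPr.
Qed.

Lemma cat_continuous x y z (p : path x y) (q : path y z) :
  continuous (cat_fun p q).
Proof.
apply: glue_continuous; first exact: val_unitI_continuous.
- by apply: path_comp_continuous; apply: half_continuous; exact: val_unitI_continuous.
- by apply: path_comp_continuous; apply: half2_continuous; exact: val_unitI_continuous.
- by move=> s ->; rewrite clampI_ge1 ?clampI_le0 ?path_one ?path_zero//; lra.
Qed.

Lemma cat_zero x y z (p : path x y) (q : path y z) : cat_fun p q zero = x.
Proof.
rewrite /cat_fun val_zero ifT; last lra.
by rewrite clampI_le0 ?path_zero//; lra.
Qed.

Lemma cat_one x y z (p : path x y) (q : path y z) : cat_fun p q one = z.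
Proof.
rewrite /cat_fun val_one ifF; last by apply/negbTE; rewrite -ltNge; lra.
by rewrite clampI_ge1 ?path_one//; lra.
Qed.

Definition path_cat x y z (p : path x y) (q : path y z) : path x z :=
  mk_path (@cat_continuous _ _ _ p q) (cat_zero p q) (cat_one p q).

Lemma path_cat_le x y z (p : path x y) (q : path y z) s :
  ival s <= 2^-1 -> path_cat p q s = p (clampI (2 * ival s)).
Proof. by move=> s2; rewrite /= /mk_path /cat_fun s2. Qed.

Lemma path_cat_gt x y z (p : path x y) (q : path y z) s :
  2^-1 < ival s -> path_cat p q s = q (clampI (2 * ival s - 1)).
Proof. by move=> s2; rewrite /= /mk_path /cat_fun leNgt s2. Qed.

Definition rev_fun x y (p : path x y) (s : unitI R) : T :=
  p (clampI (1 - ival s)).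

Lemma rev_unitI_continuous (X : topologicalType) (f : X -> R) :
  continuous f -> continuous (fun s => clampI (1 - f s)).
Proof.
move=> cf; apply: clamp_comp_continuous => s.
by apply: cvgB; [exact: cvg_cst|exact: cf].
Qed.

Lemma rev_continuous x y (p : path x y) : continuous (rev_fun p).
Proof.
by apply: path_comp_continuous; apply: rev_unitI_continuous; exact: val_unitI_continuous.
Qed.

Lemma rev_zero x y (p : path x y) : rev_fun p zero = y.
Proof. by rewrite /rev_fun val_zero subr0 clampI_ge1 ?path_one. Qed.

Lemma rev_one x y (p : path x y) : rev_fun p one = x.
Proof. by rewrite /rev_fun val_one subrr clampI_le0 ?path_zero. Qed.

Definition path_rev x y (p : path x y) : path y x :=
  mk_path (@rev_continuous _ _ p) (rev_zero p) (rev_one p).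

Definition path_cst x : path x x := cst x.

(* Homotopy relative to the endpoints; the second factor is the time. *)
Definition path_homotopic x y (p q : path x y) : Prop :=
  exists H : unitI R * unitI R -> T,
    [/\ continuous H,
        (forall s, H (s, zero) = p s), (forall s, H (s, one) = q s),
        (forall t, H (zero, t) = x) & (forall t, H (one, t) = y)].

Lemma path_homotopic_refl x y (p : path x y) : path_homotopic p p.
Proof.
exists (fun st => p st.1); split => //=.
- by apply: path_comp_continuous => st; exact: cvg_fst.
- by move=> _; exact: path_zero.
- by move=> _; exact: path_one.
Qed.

Lemma pair_continuous (X Y Z : topologicalType) (f : X -> Y) (g : X -> Z) :
  continuous f -> continuous g -> continuous (fun s => (f s, g s)).
Proof. by move=> cf cg s; apply: cvg_pair; [exact: cf|exact: cg]. Qed.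

Lemma fst_continuous (X Y : topologicalType) : continuous (@fst X Y).
Proof. by move=> s; exact: cvg_fst. Qed.

Lemma snd_continuous (X Y : topologicalType) : continuous (@snd X Y).
Proof. by move=> s; exact: cvg_snd. Qed.

Lemma comp2_continuous (X : topologicalType) (H : unitI R * unitI R -> T)
    (f g : X -> unitI R) :
  continuous H -> continuous f -> continuous g ->
  continuous (fun s => H (f s, g s)).
Proof.
move=> cH cf cg s; apply: (@continuous_comp _ _ _ (fun s => (f s, g s)) H).
  exact: pair_continuous.
exact: cH.
Qed.

Lemma val_fst_continuous :
  continuous (fun st : unitI R * unitI R => ival st.1).
Proof. by apply: val_continuous_comp; exact: fst_continuous. Qed.

Lemma val_snd_continuous :
  continuous (fun st : unitI R * unitI R => ival st.2).
Proof. by apply: val_continuous_comp; exact: snd_continuous. Qed.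

Lemma path_homotopic_sym x y (p q : path x y) :
  path_homotopic p q -> path_homotopic q p.
Proof.
move=> [H [cH H0 H1 Hx Hy]].
exists (fun st => H (st.1, clampI (1 - ival st.2))); split => //=.
- apply: comp2_continuous => //; first exact: fst_continuous.
  exact: rev_unitI_continuous val_snd_continuous.
- by move=> s; rewrite val_zero subr0 clampI_ge1// H1.
- by move=> s; rewrite val_one subrr clampI_le0// H0.
Qed.

Lemma path_homotopic_trans x y (q p r : path x y) :
  path_homotopic p q -> path_homotopic q r -> path_homotopic p r.
Proof.
move=> [H [cH H0 H1 Hx Hy]] [K [cK K0 K1 Kx Ky]].
exists (fun st => if ival st.2 <= 2^-1 then H (st.1, clampI (2 * ival st.2))
                  else K (st.1, clampI (2 * ival st.2 - 1))); split => /=.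
- apply: (@glue_continuous _ _ _ (fun st : unitI R * unitI R => ival st.2)).
  + exact: val_snd_continuous.
  + apply: comp2_continuous => //; first exact: fst_continuous.
    exact: half_continuous val_snd_continuous.
  + apply: comp2_continuous => //; first exact: fst_continuous.
    exact: half2_continuous val_snd_continuous.
  + by move=> st ->; rewrite clampI_ge1 ?clampI_le0 ?H1 ?K0//; lra.
- move=> s; rewrite val_zero ifT; last lra.
  by rewrite clampI_le0 ?H0//; lra.
- move=> s; rewrite val_one ifF; last by apply/negbTE; rewrite -ltNge; lra.
  by rewrite clampI_ge1 ?K1//; lra.
- by move=> t; case: ifP.
- by move=> t; case: ifP.
Qed.

Lemma path_cat_homotopic x y z (p p' : path x y) (q q' : path y z) :
  path_homotopic p p' -> path_homotopic q q' ->
  path_homotopic (path_cat p q) (path_cat p' q').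
Proof.
move=> [H [cH H0 H1 Hx Hy]] [K [cK K0 K1 Kx Ky]].
exists (fun st => if ival st.1 <= 2^-1 then H (clampI (2 * ival st.1), st.2)
                  else K (clampI (2 * ival st.1 - 1), st.2)); split => /=.
- apply: (@glue_continuous _ _ _ (fun st : unitI R * unitI R => ival st.1)).
  + exact: val_fst_continuous.
  + apply: comp2_continuous => //; last exact: snd_continuous.
    exact: half_continuous val_fst_continuous.
  + apply: comp2_continuous => //; last exact: snd_continuous.
    exact: half2_continuous val_fst_continuous.
  + by move=> st ->; rewrite clampI_ge1 ?clampI_le0 ?Hy ?Kx//; lra.
- by move=> s; rewrite H0 K0.
- by move=> s; rewrite H1 K1.
- move=> s; rewrite val_zero ifT; last lra.
  by rewrite clampI_le0 ?Hx//; lra.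
- move=> s; rewrite val_one ifF; last by apply/negbTE; rewrite -ltNge; lra.
  by rewrite clampI_ge1 ?Ky//; lra.
Qed.

Lemma path_rev_homotopic x y (p q : path x y) :
  path_homotopic p q -> path_homotopic (path_rev p) (path_rev q).
Proof.
move=> [H [cH H0 H1 Hx Hy]].
exists (fun st => H (clampI (1 - ival st.1), st.2)); split => /=.
- apply: comp2_continuous => //; last exact: snd_continuous.
  exact: rev_unitI_continuous val_fst_continuous.
- by move=> s; rewrite H0.
- by move=> s; rewrite H1.
- by move=> t; rewrite val_zero subr0 clampI_ge1// Hy.
- by move=> t; rewrite val_one subrr clampI_le0// Hx.
Qed.

(* Two reparametrizations of a path with the same endpoints are homotopic,
   because the unit interval is convex. *)
Lemma reparam_homotopic x y z w (f : path x y) (p q : path z w)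
    (phi psi : unitI R -> R) :
  continuous phi -> continuous psi ->
  (forall s, p s = f (clampI (phi s))) ->
  (forall s, q s = f (clampI (psi s))) ->
  clampI (phi zero) = clampI (psi zero) ->
  clampI (phi one) = clampI (psi one) ->
  path_homotopic p q.
Proof.
move=> cphi cpsi pE qE e0 e1.
pose a s := ival (clampI (phi s)); pose b s := ival (clampI (psi s)).
have ca : continuous a.
  by apply: val_continuous_comp; exact: clamp_comp_continuous.
have cb : continuous b.
  by apply: val_continuous_comp; exact: clamp_comp_continuous.
exists (fun st => f (clampI ((1 - ival st.2) * a st.1 + ival st.2 * b st.1))).
split => /=.
- apply: path_comp_continuous; apply: clamp_comp_continuous => st.
  apply: cvgD; apply: cvgM.
  + by apply: cvgB; [exact: cvg_cst|exact: val_snd_continuous].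
  + apply: (@continuous_comp _ _ _ fst a); first exact: fst_continuous.
    exact: ca.
  + exact: val_snd_continuous.
  + apply: (@continuous_comp _ _ _ fst b); first exact: fst_continuous.
    exact: cb.
- by move=> s; rewrite val_zero subr0 mul1r mul0r addr0 /a clampIK pE.
- by move=> s; rewrite val_one subrr mul0r mul1r add0r /b clampIK qE.
- move=> t; rewrite /a /b -e0 -mulrDl subrK mul1r clampIK -pE.
  exact: path_zero.
- move=> t; rewrite /a /b -e1 -mulrDl subrK mul1r clampIK -pE.
  exact: path_one.
Qed.

Lemma clampIE (t : R) (s : unitI R) : t = ival s -> clampI t = s.
Proof. by move=> ->; rewrite clampIK. Qed.

Let vcont := @val_unitI_continuous R.

Lemma path_catA x y z w (p : path x y) (q : path y z) (r : path z w) :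
  path_homotopic (path_cat p (path_cat q r)) (path_cat (path_cat p q) r).
Proof.
apply: (@reparam_homotopic _ _ _ _ (path_cat (path_cat p q) r) _ _
  (fun s => Order.max (2^-1 * ival s + 0)
     (Order.max (1 * ival s - 4^-1) (2 * ival s - 1))) (fun s => ival s)).
- move=> s; apply: (@continuous_max R _ (fun s : unitI R => 2^-1 * ival s + 0)
    (fun s => Order.max (1 * ival s - 4^-1) (2 * ival s - 1))).
    exact: lin_continuous.
  apply: (@continuous_max R _ (fun s : unitI R => 1 * ival s - 4^-1)
    (fun s => 2 * ival s - 1)); exact: lin_continuous.
- exact: vcont.
- move=> s; have s0 := unitI_ge0 s; have s1 := unitI_le1 s.
  have [s2|s2] := leP (ival s) 2^-1.
    rewrite (max_idPl _); last by rewrite ge_max; apply/andP; split; lra.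
    have e : ival (clampI (2^-1 * ival s + 0)) = 2^-1 * ival s.
      by rewrite val_clampI; [lra | apply/andP; split; lra].
    have e' : ival (clampI (2 * (2^-1 * ival s))) = ival s.
      by rewrite val_clampI; [lra | apply/andP; split; lra].
    by rewrite path_cat_le// [RHS]path_cat_le e ?path_cat_le ?e'//; lra.
  have [s3|s3] := leP (ival s) (3 / 4).
    rewrite (max_idPr _); last by rewrite le_max; apply/orP; left; lra.
    rewrite (max_idPl _); last lra.
    have e : ival (clampI (1 * ival s - 4^-1)) = ival s - 4^-1.
      by rewrite val_clampI; [lra | apply/andP; split; lra].
    have e' : ival (clampI (2 * ival s - 1)) = 2 * ival s - 1.
      by rewrite val_clampI; [lra | apply/andP; split; lra].
    have e2 : ival (clampI (2 * (ival s - 4^-1))) = 2 * ival s - 2^-1.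
      by rewrite val_clampI; [lra | apply/andP; split; lra].
    rewrite path_cat_gt// path_cat_le ?e'; last lra.
    rewrite path_cat_le e; last lra.
    rewrite path_cat_gt ?e2; last lra.
    by congr (q (clampI _)); lra.
  rewrite (max_idPr _); last by rewrite le_max; apply/orP; left; lra.
  rewrite (max_idPr _); last lra.
  have e' : ival (clampI (2 * ival s - 1)) = 2 * ival s - 1.
    by rewrite val_clampI; [lra | apply/andP; split; lra].
  rewrite path_cat_gt// path_cat_gt ?e'; last lra.
  by rewrite path_cat_gt e'//; lra.
- by move=> s; rewrite clampIK.
- rewrite clampIK; apply: clampI_le0; rewrite val_zero !ge_max.
  by apply/and3P; split; lra.
- rewrite clampIK; apply: clampI_ge1; rewrite val_one !le_max.
  by apply/or3P; apply: Or33; lra.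
Qed.

Lemma path_cat1p x y (p : path x y) :
  path_homotopic (path_cat (path_cst x) p) p.
Proof.
apply: (@reparam_homotopic _ _ _ _ p _ _
  (fun s => 2 * ival s - 1) (fun s => ival s)).
- exact: lin_continuous.
- exact: vcont.
- move=> s; have [s2|s2] := leP (ival s) 2^-1; last by rewrite path_cat_gt.
  rewrite path_cat_le//.
  rewrite [in RHS]clampI_le0; last lra.
  by rewrite path_zero.
- by move=> s; rewrite clampIK.
- by rewrite clampIK clampI_le0// val_zero; lra.
- by rewrite clampIK clampI_ge1// val_one; lra.
Qed.

Lemma path_catp1 x y (p : path x y) :
  path_homotopic (path_cat p (path_cst y)) p.
Proof.
apply: (@reparam_homotopic _ _ _ _ p _ _
  (fun s => 2 * ival s + 0) (fun s => ival s)).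
- exact: lin_continuous.
- exact: vcont.
- move=> s; rewrite addr0; have [s2|s2] := leP (ival s) 2^-1; first by rewrite path_cat_le.
  rewrite path_cat_gt//.
  rewrite [in RHS]clampI_ge1; last lra.
  by rewrite path_one.
- by move=> s; rewrite clampIK.
- by rewrite clampIK clampI_le0// val_zero; lra.
- by rewrite clampIK clampI_ge1// val_one; lra.
Qed.

Lemma path_catpV x y (p : path x y) :
  path_homotopic (path_cat p (path_rev p)) (path_cst x).
Proof.
apply: (@reparam_homotopic _ _ _ _ p _ _
  (fun s => Order.min (2 * ival s + 0) (- 2 * ival s + 2)) (fun=> 0)).
- move=> s; apply: (@continuous_min R _ (fun s : unitI R => 2 * ival s + 0)
    (fun s => - 2 * ival s + 2)); exact: lin_continuous.
- exact: cst_continuous.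
- move=> s; have s0 := unitI_ge0 s; have s1 := unitI_le1 s.
  have [s2|s2] := leP (ival s) 2^-1.
    by rewrite path_cat_le// (min_idPl _) ?addr0//; lra.
  rewrite path_cat_gt// (min_idPr _); last lra.
  rewrite /= /mk_path /rev_fun val_clampI; last by apply/andP; split; lra.
  by congr (p (clampI _)); lra.
- by move=> s; rewrite clampI_le0 ?path_zero.
- by congr clampI; rewrite val_zero (min_idPl _); lra.
- by congr clampI; rewrite val_one (min_idPr _); lra.
Qed.

Lemma path_catVp x y (p : path x y) :
  path_homotopic (path_cat (path_rev p) p) (path_cst y).
Proof.
apply: (@reparam_homotopic _ _ _ _ p _ _
  (fun s => Order.max (- 2 * ival s + 1) (2 * ival s - 1)) (fun=> 1)).
- move=> s; apply: (@continuous_max R _ (fun s : unitI R => - 2 * ival s + 1)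
    (fun s => 2 * ival s - 1)); exact: lin_continuous.
- exact: cst_continuous.
- move=> s; have s0 := unitI_ge0 s; have s1 := unitI_le1 s.
  have [s2|s2] := leP (ival s) 2^-1.
    rewrite path_cat_le// (max_idPl _); last lra.
    rewrite /= /mk_path /rev_fun val_clampI; last by apply/andP; split; lra.
    by congr (p (clampI _)); lra.
  by rewrite path_cat_gt// (max_idPr _)//; lra.
- by move=> s; rewrite clampI_ge1 ?path_one.
- by congr clampI; rewrite val_zero (max_idPl _); lra.
- by congr clampI; rewrite val_one (max_idPr _); lra.
Qed.

End PathAlgebra.

Section FundamentalGroup.
Context (R : realType) (T : topologicalType) (x : T).

Definition loop : Type := {path (unitI R) from x to x in T}.
HB.instance Definition _ := Choice.on loop.

Definition loop_rel (p q : loop) : bool := `[< path_homotopic p q >].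

Lemma loop_rel_refl : reflexive loop_rel.
Proof. by move=> p; apply/asboolP; exact: path_homotopic_refl. Qed.

Lemma loop_rel_sym : symmetric loop_rel.
Proof. by move=> p q; apply: asbool_equiv_eq; split; exact: path_homotopic_sym. Qed.

Lemma loop_rel_trans : transitive loop_rel.
Proof.
move=> q p r /asboolP pq /asboolP qr; apply/asboolP.
exact: path_homotopic_trans pq qr.
Qed.

Definition loop_equiv :=
  EquivRel loop_rel loop_rel_refl loop_rel_sym loop_rel_trans.

Definition pi1 : Type := {eq_quot loop_equiv}.
HB.instance Definition _ := Choice.on pi1.
HB.instance Definition _ := Quotient.on pi1.

Definition loop_class (p : loop) : pi1 := \pi_{eq_quot loop_equiv} p.

Lemma loop_classP (p q : loop) :
  loop_class p = loop_class q <-> path_homotopic p q.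
Proof. by split => [/eqmodP/asboolP//|pq]; apply/eqmodP/asboolP. Qed.

Lemma loop_class_surj (a : pi1) : exists p, a = loop_class p.
Proof. by exists (repr (a : {eq_quot loop_equiv})); rewrite /loop_class reprK. Qed.

Definition pi1_mul (a b : pi1) : pi1 :=
  loop_class (path_cat (repr (a : {eq_quot loop_equiv}))
                       (repr (b : {eq_quot loop_equiv}))).
Definition pi1_one : pi1 := loop_class (path_cst x).
Definition pi1_inv (a : pi1) : pi1 :=
  loop_class (path_rev (repr (a : {eq_quot loop_equiv}))).

Lemma repr_loop_class (p : loop) :
  path_homotopic (repr (loop_class p : {eq_quot loop_equiv})) p.
Proof. by apply/loop_classP; rewrite /loop_class reprK. Qed.

Lemma pi1_mulE (p q : loop) :
  pi1_mul (loop_class p) (loop_class q) = loop_class (path_cat p q).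
Proof. by apply/loop_classP/path_cat_homotopic; exact: repr_loop_class. Qed.

Lemma pi1_invE (p : loop) : pi1_inv (loop_class p) = loop_class (path_rev p).
Proof. by apply/loop_classP/path_rev_homotopic; exact: repr_loop_class. Qed.

Lemma pi1_mulA : associative pi1_mul.
Proof.
move=> a b c; have [p ->] := loop_class_surj a.
have [q ->] := loop_class_surj b; have [r ->] := loop_class_surj c.
by rewrite !pi1_mulE; apply/loop_classP; exact: path_catA.
Qed.

Lemma pi1_1mul : left_id pi1_one pi1_mul.
Proof.
move=> a; have [p ->] := loop_class_surj a.
by rewrite pi1_mulE; apply/loop_classP; exact: path_cat1p.
Qed.

Lemma pi1_mul1 : right_id pi1_one pi1_mul.
Proof.
move=> a; have [p ->] := loop_class_surj a.
by rewrite pi1_mulE; apply/loop_classP; exact: path_catp1.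
Qed.

Lemma pi1_Vmul : left_inverse pi1_one pi1_inv pi1_mul.
Proof.
move=> a; have [p ->] := loop_class_surj a.
by rewrite pi1_invE pi1_mulE; apply/loop_classP; exact: path_catVp.
Qed.

Lemma pi1_mulV : right_inverse pi1_one pi1_inv pi1_mul.
Proof.
move=> a; have [p ->] := loop_class_surj a.
by rewrite pi1_invE pi1_mulE; apply/loop_classP; exact: path_catpV.
Qed.

HB.instance Definition _ := isGroup.Build pi1
  pi1_mulA pi1_1mul pi1_mul1 pi1_Vmul pi1_mulV.

End FundamentalGroup.

Definition trivial_group (G : groupType) : Prop := forall a : G, a = 1%g.

Definition isomorphic_groups (G H : groupType) : Prop :=
  exists f : {multiplicative G -> H}, bijective f.

Definition config (h : nat) (M : topologicalType) : topologicalType :=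
  [set x : prod_topology (fun _ : 'I_h => M) | injective x].

Definition pure_braid_group (R : realType) (h : nat) (M : topologicalType)
  (x : config h M) : groupType := pi1 R x.

Section Grassmannian.
Context (R : realType).

(* The field R[i] of complex numbers, with the topology of its modulus (which
   the library puts on the regular module only). *)
Local Notation C := (R[i]^o).

Definition subspaces (k n : nat) : Type :=
  {V : {vspace 'rV[C]_n} | \dim V == k}.

Definition full_rank (k n : nat) : set 'M[C]_(k, n) :=
  [set A | row_free A].
Arguments full_rank : clear implicits.

Definition row_span k n (A : 'M[C]_(k, n)) : {vspace 'rV[C]_n} :=
  <<[tuple row j A | j < k]>>%VS.

Lemma row_comb k n (A : 'M[C]_(k, n)) (u : 'I_k -> C) :
  \sum_(j < k) u j *: [tuple row j A | j < k]`_j = (\row_j u j) *m A.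
Proof.
rewrite mulmx_sum_row; apply: eq_bigr => j _.
by rewrite mxE -tnth_nth tnth_mktuple.
Qed.

Lemma free_rowsE k n (A : 'M[C]_(k, n)) :
  free [tuple row j A | j < k] = row_free A.
Proof.
apply/idP/idP => [/freeP fA|/row_freeP[B AB]].
  apply/inj_row_free => v vA; apply/rowP => j; rewrite mxE.
  apply: (fA (fun j => v 0 j)); rewrite (row_comb A (v 0)).
  by have <- : v = \row_j v 0 j by apply/rowP => l; rewrite mxE.
apply/freeP => u; rewrite row_comb => uA j.
have : (\row_j u j) *m A *m B = 0 by rewrite uA mul0mx.
by rewrite -mulmxA AB mulmx1 => /rowP/(_ j); rewrite !mxE.
Qed.

Lemma dim_row_span k n (A : full_rank k n) : \dim (row_span (\val A)) == k.
Proof.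
case: A => A /= /set_mem; rewrite /full_rank /= -free_rowsE => fA.
by have := eqP fA; rewrite size_tuple => ->.
Qed.

Definition span_of k n (A : full_rank k n) : subspaces k n :=
  exist _ (row_span (\val A)) (dim_row_span A).

Definition basis_mx k n (V : subspaces k n) : 'M[C]_(k, n) :=
  \matrix_(j < k) (vbasis (sval V))`_j.

Lemma rows_basis_mx k n (V : subspaces k n) :
  [tuple row j (basis_mx V) | j < k] = vbasis (sval V) :> seq _.
Proof.
apply: (@eq_from_nth _ 0); first by rewrite !size_tuple; exact/esym/eqP/(svalP V).
move=> j; rewrite size_tuple => jk.
by rewrite (_ : j = Ordinal jk)// -tnth_nth tnth_mktuple rowK.
Qed.

Lemma row_span_basis_mx k n (V : subspaces k n) :
  row_span (basis_mx V) = sval V.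
Proof. by rewrite /row_span rows_basis_mx; exact: span_basis (vbasisP _). Qed.

Lemma basis_mx_full_rank k n (V : subspaces k n) :
  basis_mx V \in full_rank k n.
Proof.
apply/mem_set; rewrite /full_rank /= -free_rowsE rows_basis_mx.
exact: basis_free (vbasisP _).
Qed.

Definition basis_of k n (V : subspaces k n) : full_rank k n :=
  exist (fun A => A \in full_rank k n) _ (basis_mx_full_rank V).

Lemma basis_ofK k n : cancel (@basis_of k n) (@span_of k n).
Proof. by move=> V; apply: val_inj; exact: row_span_basis_mx. Qed.

HB.instance Definition _ k n :=
  isQuotient.Build (full_rank k n) (subspaces k n) (@basis_ofK k n).

(* The topology is the quotient topology along the map sending a full-rank
   matrix to its row space. *)
Definition Gr (k n : nat) : topologicalType :=
  quotient_topology (subspaces k n).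

Definition gr_space k n (V : Gr k n) : {vspace 'rV[C]_n} :=
  sval (V : subspaces k n).

(* The i-th ordered configuration space of h subspaces of dimension k; for
   hyperplane arrangements, k = n - 1. *)
Definition config_dim (h i k n : nat) : topologicalType :=
  [set x : prod_topology (fun _ : 'I_h => Gr k n) |
    injective x /\ \dim (\sum_(a < h) gr_space (x a))%VS = i].

(* Complex projective m-space is the set of lines of C^(m+1), with the quotient
   topology along the map sending a nonzero vector to its span. *)
Definition lines (m : nat) : Type :=
  {L : {vspace 'rV[C]_m.+1} | \dim L == 1%N}.

Definition nonzero (m : nat) : set 'rV[C]_m.+1 := [set v | v != 0].
Arguments nonzero : clear implicits.

Lemma dim_span1 m (v : nonzero m) : \dim <[\val v]>%VS == 1%N.
Proof. by case: v => v /= /set_mem v0; rewrite dim_vline v0. Qed.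

Definition line_of m (v : nonzero m) : lines m :=
  exist _ <[\val v]>%VS (dim_span1 v).

Lemma vpick_nonzero m (L : lines m) : vpick (sval L) \in nonzero m.
Proof.
by apply/mem_set; rewrite /nonzero /= vpick0 -dimv_eq0 (eqP (svalP L)).
Qed.

Definition direction m (L : lines m) : nonzero m :=
  exist (fun v => v \in nonzero m) _ (vpick_nonzero L).

Lemma directionK m : cancel (@direction m) (@line_of m).
Proof.
move=> L; apply: val_inj; apply/eqP; rewrite eqEdim /=.
rewrite -memvE memv_pick /= dim_vline (eqP (svalP L)).
by have /set_mem := vpick_nonzero L; rewrite /nonzero /= => ->.
Qed.

HB.instance Definition _ m :=
  isQuotient.Build (nonzero m) (lines m) (@directionK m).

Definition CP (m : nat) : topologicalType := quotient_topology (lines m).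

End Grassmannian.

(* Main.v *)
Require Import Defs.
From HB Require Import structures.
From mathcomp Require Import all_boot all_order all_algebra generic_quotient.
From mathcomp Require Import complex.
From mathcomp Require Import all_classical reals topology normedtype homotopy.
From mathcomp Require Import ring lra.

Set Implicit Arguments.
Unset Strict Implicit.
Unset Printing Implicit Defensive.

(** Write n = k + 1.  Two distinct hyperplanes span C^n, so the dimension of the
    sum is determined by h (dim_sum_gr) and the space at hand is the full
    configuration space of h points of Gr(k, k + 1).

    A hyperplane is given by its normal line.  For two linear functionals f and
    g on normal vectors, the configurations whose normals can be rescaled to
    satisfy f = 1, and then have pairwise distinct values of g, form an open
    chart.  The functionals are taken on the moment curve: finitely many nonzero
    vectors are polynomials with finitely many roots, so any two configurations
    lie in a common chart (common_chart).

    Two configurations in the intersection of two charts are joined inside that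
    intersection: on the complex line through their normals the bad parameters
    are the roots of one nonzero polynomial, and a path in C from 0 to 1 avoids
    them (chart_link).  In particular the configuration space is path connected.

    If k >= 2, some e <> 0 is killed by f and by g.  Moving the normals along e
    does not change f and g, hence keeps the hyperplanes apart, and one can reach
    fixed distinct coordinates along e; these then keep the hyperplanes apart
    while everything else is contracted to a point.  So a chart is contractible
    in the whole space (chart_inessential).  A loop is covered by charts that
    contain its base point, and the elementary half of van Kampen's theorem
    (pi1_trivial_cover) makes it null-homotopic.

    If n = 2, then Gr(1, 2) and CP^1 are the same quotient of the nonzero
    vectors of C^2, so the two configuration spaces are homeomorphic, and a path
    between the base points finishes the proof (isomorphic_pi1_line). *)

Import Order.TTheory GRing.Theory Num.Theory.
Import numFieldTopology.Exports numFieldNormedType.Exports.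

Local Open Scope classical_set_scope.
Local Open Scope ring_scope.

(** * Homotopies from maps of the square *)

Section Squares.
Context {R : realType} {T : topologicalType}.
Local Notation path x y := {path (unitI R) from x to y in T}.
Implicit Types (x y z : T) (s t u v : unitI R).

Definition segI t u v : unitI R :=
  clampI ((1 - ival t) * ival u + ival t * ival v).

Lemma segI0 u v : segI zero u v = u.
Proof. by rewrite /segI val_zero subr0 mul1r mul0r addr0 clampIK. Qed.

Lemma segI1 u v : segI one u v = v.
Proof. by rewrite /segI val_one subrr mul1r mul0r add0r clampIK. Qed.

Lemma segIxx t u : segI t u u = u.
Proof. by rewrite /segI -mulrDl subrK mul1r clampIK. Qed.

Lemma ival_segI t u v :
  ival (segI t u v) = (1 - ival t) * ival u + ival t * ival v.
Proof.
have [t0 t1] := (unitI_ge0 t, unitI_le1 t).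
have [u0 u1] := (unitI_ge0 u, unitI_le1 u).
have [v0 v1] := (unitI_ge0 v, unitI_le1 v).
by rewrite val_clampI//; apply/andP; split; nra.
Qed.

Lemma segI_continuous (X : topologicalType) (a b c : X -> unitI R) :
  continuous a -> continuous b -> continuous c ->
  continuous (fun w => segI (a w) (b w) (c w)).
Proof.
move=> ca cb cc; apply: clamp_comp_continuous => s.
apply: cvgD; apply: cvgM; [|exact: val_continuous_comp..].
by apply: cvgB; [exact: cvg_cst|exact: val_continuous_comp].
Qed.

(** The square is convex, so two paths of the square with the same ends are
    homotopic there; the map [K] carries this homotopy to [T]. *)
Lemma square_homotopic (K : unitI R * unitI R -> T) x y (p q : path x y)
    (a a' b b' : unitI R -> unitI R) :
  continuous K -> continuous a -> continuous a' ->
  continuous b -> continuous b' ->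
  (forall s, p s = K (a s, a' s)) -> (forall s, q s = K (b s, b' s)) ->
  a zero = b zero -> a' zero = b' zero ->
  a one = b one -> a' one = b' one ->
  path_homotopic p q.
Proof.
move=> cK ca ca' cb cb' pE qE e0 e0' e1 e1'.
have comp1 (f : unitI R -> unitI R) : continuous f ->
    continuous (fun st : unitI R * unitI R => f st.1).
  move=> cf st; apply: (@continuous_comp _ _ _ fst f); last exact: cf.
  exact: fst_continuous.
exists (fun st => K (segI st.2 (a st.1) (b st.1), segI st.2 (a' st.1) (b' st.1))).
split => /=.
- apply: comp2_continuous => //; apply: segI_continuous; try exact: comp1.
  + exact: snd_continuous.
  + exact: snd_continuous.
- by move=> s; rewrite !segI0 pE.
- by move=> s; rewrite !segI1 qE.
- by move=> t; rewrite e0 e0' !segIxx -qE path_zero.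
- by move=> t; rewrite e1 e1' !segIxx -qE path_one.
Qed.

(** Each of the two paths is homotopic to the path along the three other sides of
    its square.  The squares agree on these three sides, so the two detours are
    the same path. *)
Lemma contract_homotopic (c : T) (K L : unitI R * unitI R -> T) x y
    (p q : path x y) :
  continuous K -> continuous L ->
  (forall s, K (s, zero) = p s) -> (forall s, L (s, zero) = q s) ->
  (forall s, K (s, one) = c) -> (forall s, L (s, one) = c) ->
  (forall t, K (zero, t) = L (zero, t)) ->
  (forall t, K (one, t) = L (one, t)) ->
  path_homotopic p q.
Proof.
move=> cK cL K0 L0 K1 L1 KLz KLo.
(* The three other sides of the square: up the left side while b1 = 0, across
   the top while b2 = 1, down the right side while b1 = 1. *)
pose b1 s : unitI R := clampI (4 * ival s - 3 / 2).
pose b2 s : unitI R := clampI (Order.min (4 * ival s + 0) (- 4 * ival s + 4)).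
have vc := @val_unitI_continuous R.
have cb1 : continuous b1.
  by apply: clamp_comp_continuous; exact: (@lin_continuous R _ _ _ (- (3 / 2))).
have cb2 : continuous b2.
  apply: clamp_comp_continuous => s.
  by apply: (@continuous_min R _ (fun s : unitI R => 4 * ival s + 0)
    (fun s => - 4 * ival s + 4)); exact: lin_continuous.
have KLb s : K (b1 s, b2 s) = L (b1 s, b2 s).
  have [s1|s1] := leP (ival s) (3 / 8).
    by rewrite /b1 clampI_le0 ?KLz//; lra.
  have [s2|s2] := leP (5 / 8) (ival s).
    by rewrite /b1 clampI_ge1 ?KLo//; lra.
  by rewrite /b2 clampI_ge1 ?K1 ?L1// le_min; apply/andP; split; lra.
have b10 : b1 zero = zero by apply: clampI_le0; rewrite val_zero; lra.
have b11 : b1 one = one by apply: clampI_ge1; rewrite val_one; lra.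
have b20 : b2 zero = zero.
  by apply: clampI_le0; rewrite val_zero ge_min; apply/orP; left; lra.
have b21 : b2 one = zero.
  by apply: clampI_le0; rewrite val_one ge_min; apply/orP; right; lra.
have cr : continuous (fun s => K (b1 s, b2 s)) by exact: comp2_continuous.
have r0 : K (b1 zero, b2 zero) = x by rewrite b10 b20 K0 path_zero.
have r1 : K (b1 one, b2 one) = y by rewrite b11 b21 K0 path_one.
pose r : path x y := mk_path cr r0 r1.
have cid : continuous (fun s : unitI R => s) by move=> s; exact: cvg_id.
have c0 : continuous (fun _ : unitI R => (zero : unitI R)).
  exact: cst_continuous.
apply: (@path_homotopic_trans _ _ _ _ r).
  by apply: (@square_homotopic K _ _ p r id (fun=> zero) b1 b2).
apply: path_homotopic_sym.
by apply: (@square_homotopic L _ _ q r id (fun=> zero) b1 b2).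
Qed.

End Squares.

(** * Simple connectivity from an open cover *)

Section Cover.
Context {R : realType} {T : topologicalType}.
Local Notation path x y := {path (unitI R) from x to y in T}.
Implicit Types (x y z : T) (s t u v : unitI R).

Lemma lin2_continuous (X : topologicalType) (f g : X -> R) (a b c : R) :
  continuous f -> continuous g -> continuous (fun w => a * f w + b * g w + c).
Proof.
move=> cf cg w; apply: cvgD; last exact: cvg_cst.
by apply: cvgD; apply: cvgM;
  [exact: cvg_cst|exact: cf|exact: cvg_cst|exact: cg].
Qed.

Section SubPath.
Context (x y : T) (p : path x y).

Lemma sub_path_continuous u v : continuous (fun s => p (segI s u v)).
Proof.
apply: path_comp_continuous; apply: segI_continuous.
- by move=> s; exact: cvg_id.
- exact: cst_continuous.
- exact: cst_continuous.
Qed.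

Lemma sub_path_zero u v : p (segI zero u v) = p u. Proof. by rewrite segI0. Qed.
Lemma sub_path_one u v : p (segI one u v) = p v. Proof. by rewrite segI1. Qed.

Definition sub_path u v : path (p u) (p v) :=
  mk_path (@sub_path_continuous u v) (sub_path_zero u v) (sub_path_one u v).

(** Both sides run through [p] from [u] to [w] at different speeds. *)
Lemma sub_path_cat u v w :
  path_homotopic (path_cat (sub_path u v) (sub_path v w)) (sub_path u w).
Proof.
have vc := @val_unitI_continuous R.
pose fst2 s : unitI R := clampI (2 * ival s).
pose snd2 s : unitI R := clampI (2 * ival s - 1).
have cfst : continuous fst2 by exact: half_continuous.
have csnd : continuous snd2 by exact: half2_continuous.
apply: (@reparam_homotopic _ _ _ _ _ _ p _ _
  (fun s => (ival v - ival u) * ival (fst2 s) +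
            (ival w - ival v) * ival (snd2 s) + ival u)
  (fun s => (ival w - ival u) * ival s + ival u)).
- by apply: lin2_continuous; exact: val_continuous_comp.
- exact: lin_continuous.
- move=> s; have [s2|s2] := leP (ival s) 2^-1.
    rewrite path_cat_le//= /mk_path; congr (p _); apply: val_inj.
    have -> : snd2 s = zero by apply: clampI_le0; lra.
    rewrite -/(fst2 s) -[LHS]/(ival _) ival_segI val_zero mulr0 addr0; set t := fst2 s.
    have -> : (1 - ival t) * ival u + ival t * ival v =
      (ival v - ival u) * ival t + ival u by ring.
    rewrite -[RHS]/(ival _) val_clampI//.
    have [? ?] := (unitI_ge0 t, unitI_le1 t).
    have [? ?] := (unitI_ge0 u, unitI_le1 u).
    by have [? ?] := (unitI_ge0 v, unitI_le1 v); apply/andP; split; nra.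
  rewrite path_cat_gt//= /mk_path; congr (p _); apply: val_inj.
  have -> : fst2 s = one by apply: clampI_ge1; lra.
  rewrite -/(snd2 s) -[LHS]/(ival _) ival_segI val_one; set t := snd2 s.
  have -> : (1 - ival t) * ival v + ival t * ival w =
    (ival v - ival u) * 1 + (ival w - ival v) * ival t + ival u by ring.
  rewrite -[RHS]/(ival _) val_clampI//.
  have [? ?] := (unitI_ge0 t, unitI_le1 t).
  have [? ?] := (unitI_ge0 w, unitI_le1 w).
  by have [? ?] := (unitI_ge0 v, unitI_le1 v); apply/andP; split; nra.
- by move=> s; rewrite /= /mk_path /segI; congr (p (clampI _)); ring.
- have -> : fst2 zero = zero by apply: clampI_le0; rewrite val_zero; lra.
  have -> : snd2 zero = zero by apply: clampI_le0; rewrite val_zero; lra.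
  by congr clampI; rewrite val_zero; ring.
- have -> : fst2 one = one by apply: clampI_ge1; rewrite val_one; lra.
  have -> : snd2 one = one by apply: clampI_ge1; rewrite val_one; lra.
  by congr clampI; rewrite val_one; ring.
Qed.

Lemma sub_path_self u : sub_path u u =1 path_cst (p u).
Proof. by move=> s; rewrite /= /mk_path segIxx. Qed.

End SubPath.


(** The set of times where [Q] holds is open and closed; it is pulled back to the
    real line along the clamping map, where connectedness is available. *)
Lemma unitI_locally_constant (Q : unitI R -> Prop) :
  (forall s, exists2 N, nbhs s N & forall t u, N t -> N u -> Q t -> Q u) ->
  Q zero -> Q one.
Proof.
move=> Qloc Q0; pose B := [set r : R | Q (clampI r)].
have near_clamp (r : R) : exists2 N, nbhs r N &
    forall t u : R, N t -> N u -> Q (clampI t) -> Q (clampI u).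
  have [N Nr QN] := Qloc (clampI r); exists (clampI @^-1` N) => [|t u]; last exact: QN.
  exact: clampI_continuous.
have oB : open B.
  rewrite openE => r /= Br; have [N Nr QN] := near_clamp r.
  by apply: filterS (Nr) => t Nt; apply: (QN r t _ Nt) => //; exact: nbhs_singleton Nr.
have cB : closed B.
  rewrite -openC openE => r /= nBr; have [N Nr QN] := near_clamp r.
  apply: filterS (Nr) => t Nt Bt; apply: nBr.
  by apply: (QN t r Nt) => //; exact: nbhs_singleton Nr.
have cR : connected [set: R] by apply/connected_intervalP => ? ? _ _ ? _.
have BT : B = setT.
  apply: cR; first by exists 0; rewrite /B /= clampI_le0.
    by exists B => //; rewrite setTI.
  by exists B => //; rewrite setTI.
have : B 1 by rewrite BT.
by rewrite /B /= clampI_ge1.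
Qed.

Lemma unitI_convex_nbhs s (A : set (unitI R)) : nbhs s A ->
  exists N, [/\ nbhs s N, N `<=` A &
    forall r t u, N t -> N u -> N (segI r t u)].
Proof.
move=> As.
have : nbhs (ival s) (clampI @^-1` A).
  by apply: clampI_continuous; rewrite clampIK.
move=> /nbhs_ballP[e /= e0 eA]; exists (ival @^-1` ball (ival s) e); split.
- by apply: val_unitI_continuous; apply: nbhsx_ballx.
- by move=> t /eA; rewrite /preimage /= clampIK.
- move=> r t u; rewrite /preimage /= /ball /= ival_segI !ltr_distlC.
  move=> /andP[t1 t2] /andP[u1 u2].
  have [r0 r1] := (unitI_ge0 r, unitI_le1 r).
  have [tu|/ltW tu] := leP (ival t) (ival u).
    have lo : ival t <= (1 - ival r) * ival t + ival r * ival u by nra.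
    have hi : (1 - ival r) * ival t + ival r * ival u <= ival u by nra.
    by apply/andP; split; lra.
  have lo : ival u <= (1 - ival r) * ival t + ival r * ival u by nra.
  have hi : (1 - ival r) * ival t + ival r * ival u <= ival t by nra.
  by apply/andP; split; lra.
Qed.

(** For an open path connected set, this says that the inclusion into [T] is trivial
    on fundamental groups; the form with two ends needs no base point in [U]. *)
Definition inessential (U : set T) := forall x y (p q : path x y),
  (forall s, U (p s)) -> (forall s, U (q s)) -> path_homotopic p q.

Section CoverPath.
Context (J : Type) (U : J -> set T).
Hypothesis U_open : forall j, open (U j).
Hypothesis U_inessential : forall j, inessential (U j).

(** The property of a time [s] that is propagated along [p]: the part of [p] up to
    [s] is homotopic to every path from [p zero] to [p s] that stays in some member of
    the cover.  Near [s] the path [p] stays in one member [U j].  To go from [t] to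
    [u] in that neighbourhood, follow a path in [U j] to [p t] and then [p]; this
    can be replaced first by any path in [U j], then by one in the intersection of
    [U j] and [U k], and finally by any path in [U k].  Starting all members at
    [p zero] spares the choice of a subdivision. *)
Lemma cover_homotopic x y (p : path x y) :
  (forall z, exists2 j, U j (p zero) & U j z) ->
  (forall j k z, U j (p zero) -> U k (p zero) -> U j z -> U k z ->
    exists q : path (p zero) z, forall s, U j (q s) /\ U k (q s)) ->
  forall k (q : path (p zero) (p one)), (forall s, U k (q s)) ->
  path_homotopic (sub_path p zero one) q.
Proof.
move=> cover link.
pose Q s := forall k (q : path (p zero) (p s)), (forall t, U k (q t)) ->
  path_homotopic (sub_path p zero s) q.
apply: (@unitI_locally_constant Q) => [s|]; last first.
  move=> k q Uq.
  have Usub s : U k (sub_path p zero zero s).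
    by rewrite sub_path_self /=; have := Uq zero; rewrite [q zero]path_zero.
  exact: (U_inessential Usub Uq).
have [j Uj0 Ujs] := cover (p s).
have /unitI_convex_nbhs[N [Ns NU Nconv]] : nbhs s (p @^-1` U j).
  by apply: path_continuous; apply: open_nbhs_nbhs; split.
exists N => // t u Nt Nu Qt k q Ukq.
have Uk0 : U k (p zero) by have := Ukq zero; rewrite [q zero]path_zero.
have Uku : U k (p u) by have := Ukq one; rewrite [q one]path_one.
have [q' Uq'] := link j k (p u) Uj0 Uk0 (NU _ Nu) Uku.
have [d Ud] := link j j (p t) Uj0 Uj0 (NU _ Nt) (NU _ Nt).
apply: (path_homotopic_trans (q := q')); last first.
  by apply: (U_inessential (j := k)) => // r; have [] := Uq' r.
apply: (path_homotopic_trans (path_homotopic_sym (sub_path_cat p zero t u))).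
apply: (@path_homotopic_trans _ _ _ _ (path_cat d (sub_path p t u))).
  apply: path_cat_homotopic; last exact: path_homotopic_refl.
  by apply: (Qt j) => r; have [] := Ud r.
apply: (U_inessential (j := j)) => r; last by have [] := Uq' r.
have [r2|r2] := leP (ival r) 2^-1.
  by rewrite path_cat_le//; have [] := Ud (clampI (2 * ival r)).
by rewrite path_cat_gt//=; apply: NU; exact: Nconv.
Qed.

End CoverPath.

(** The half of van Kampen's theorem that needs no amalgamated product: all members
    of the cover that are used contain the base point, and only intersections of two
    members have to be path connected. *)
Lemma pi1_trivial_cover (J : Type) (U : J -> set T) x :
  (forall j, open (U j)) -> (forall j, inessential (U j)) ->
  (forall z, exists2 j, U j x & U j z) ->
  (forall j k z, U j x -> U k x -> U j z -> U k z ->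
    exists q : path x z, forall s, U j (q s) /\ U k (q s)) ->
  trivial_group (pi1 R x).
Proof.
move=> oU iU cover link a; have [p ->] := loop_class_surj a.
apply/loop_classP.
have p0 : p zero = x := @path_zero _ _ _ _ p.
have p1 : p one = x := @path_one _ _ _ _ p.
(* [cover_homotopic] compares paths from [p zero] to [p one]; these points are
   equal to [x], but only up to a proof. *)
have [j Ujx _] := cover x.
have c1 : @cst (unitI R) T x one = p one by rewrite p1.
have c0 : @cst (unitI R) T x zero = p zero by rewrite p0.
have cc : continuous (@cst (unitI R) T x) by exact: cst_continuous.
have [|||H [cH H0 H1 Hz Ho]] := @cover_homotopic J U oU iU x x p _ _ j
    (mk_path cc c0 c1).
- by rewrite p0.
- by rewrite p0.
- by [].
exists H; split => //.
- by move=> s; rewrite H0 /= /mk_path /segI val_zero val_one mulr0 mulr1 add0r clampIK.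
- by move=> t; rewrite Hz.
- by move=> t; rewrite Ho.
Qed.

End Cover.

(** * Isomorphisms of fundamental groups *)

Section GroupIso.
Context {R : realType}.

Lemma isomorphic_groups_trans (G H K : groupType) :
  isomorphic_groups G H -> isomorphic_groups H K -> isomorphic_groups G K.
Proof.
move=> [f bf] [g bg]; exists (g \o f : {multiplicative G -> K}).
exact: bij_comp.
Qed.

(** Inverse maps between loops that are defined up to homotopy and respect
    concatenation descend to the quotients. *)
Lemma isomorphic_pi1 (X Y : topologicalType) (x : X) (y : Y)
    (F : loop R x -> loop R y) (G : loop R y -> loop R x) :
  (forall p q, path_homotopic p q -> path_homotopic (F p) (F q)) ->
  (forall p q, path_homotopic p q -> path_homotopic (G p) (G q)) ->
  (forall p q, path_homotopic (F (path_cat p q)) (path_cat (F p) (F q))) ->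
  (forall p, path_homotopic (G (F p)) p) ->
  (forall p, path_homotopic (F (G p)) p) ->
  isomorphic_groups (pi1 R x) (pi1 R y).
Proof.
move=> Fh Gh Fcat GF FG.
pose f (a : pi1 R x) : pi1 R y := loop_class (F (repr a)).
pose g (b : pi1 R y) : pi1 R x := loop_class (G (repr b)).
have fE p : f (loop_class p) = loop_class (F p).
  by apply/loop_classP/Fh; exact: repr_loop_class.
have gE p : g (loop_class p) = loop_class (G p).
  by apply/loop_classP/Gh; exact: repr_loop_class.
have fM : {morph f : a b / (a * b)%g >-> (a * b)%g}.
  move=> a b; have [p ->] := loop_class_surj a; have [q ->] := loop_class_surj b.
  rewrite -[(_ * _)%g]/(pi1_mul _ _) -[RHS]/(pi1_mul _ _).
  by rewrite pi1_mulE !fE pi1_mulE; apply/loop_classP; exact: Fcat.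
pose fm := isMultiplicative.Build (pi1 R x) (pi1 R y) f fM.
pose fhom : {multiplicative pi1 R x -> pi1 R y} := HB.pack f fm.
exists fhom; exists g => [a|b] /=.
  have [p ->] := loop_class_surj a; rewrite fE gE.
  by apply/loop_classP; exact: GF.
have [q ->] := loop_class_surj b; rewrite gE fE.
by apply/loop_classP; exact: FG.
Qed.

Section Functor.
Context (X Y : topologicalType) (f : X -> Y) (cf : continuous f).

Lemma push_continuous x y (p : {path (unitI R) from x to y in X}) :
  continuous (f \o p).
Proof.
by move=> s; apply: continuous_comp; [exact: path_continuous|exact: cf].
Qed.

Lemma push_path_zero x y (p : {path (unitI R) from x to y in X}) : (f \o p) zero = f x.
Proof. by rewrite /= path_zero. Qed.

Lemma push_path_one x y (p : {path (unitI R) from x to y in X}) : (f \o p) one = f y.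
Proof. by rewrite /= path_one. Qed.

Definition push_path x y (p : {path (unitI R) from x to y in X}) :
    {path (unitI R) from (f x) to (f y) in Y} :=
  mk_path (@push_continuous _ _ p) (push_path_zero p) (push_path_one p).

Lemma push_path_homotopic x y (p q : {path (unitI R) from x to y in X}) :
  path_homotopic p q -> path_homotopic (push_path p) (push_path q).
Proof.
move=> [H [cH H0 H1 Hx Hy]]; exists (f \o H); split => /=.
- by move=> s; apply: continuous_comp; [exact: cH|exact: cf].
- by move=> s; rewrite H0.
- by move=> s; rewrite H1.
- by move=> s; rewrite Hx.
- by move=> s; rewrite Hy.
Qed.

End Functor.

Lemma path_homotopic_eq (T : topologicalType) (x y : T)
  (p q : {path (unitI R) from x to y in T}) : p =1 q -> path_homotopic p q.
Proof. by move=> /path_eqP ->; exact: path_homotopic_refl. Qed.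

Lemma isomorphic_pi1_homeo (X Y : topologicalType) (f : X -> Y) (g : Y -> X) x :
  continuous f -> continuous g -> cancel f g -> cancel g f ->
  isomorphic_groups (pi1 R x) (pi1 R (f x)).
Proof.
move=> cf cg fK gK.
(* The image of [q] under [g] is a loop at [g (f x)], to be read as one at [x]. *)
have G (q : loop R (f x)) : {r : loop R x | r =1 g \o q}.
  have c : continuous (g \o q) by exact: push_continuous.
  have e0 : (g \o q) zero = x by rewrite /= path_zero fK.
  have e1 : (g \o q) one = x by rewrite /= path_one fK.
  by exists (mk_path c e0 e1).
apply: (@isomorphic_pi1 _ _ _ _ (push_path cf (y := x)) (fun q => projT1 (G q))).
- by move=> p q; exact: push_path_homotopic.
- move=> p q [H [cH H0 H1 Hx Hy]]; exists (g \o H).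
  case: (G p) (G q) => [p' p'E] [q' q'E]; split => /=.
  + by move=> s; apply: continuous_comp; [exact: cH|exact: cg].
  + by move=> s; rewrite p'E /= H0.
  + by move=> s; rewrite q'E /= H1.
  + by move=> s; rewrite Hx fK.
  + by move=> s; rewrite Hy fK.
- move=> p q; apply: path_homotopic_eq => s.
  by rewrite /= /mk_path /= /mk_path /cat_fun /=; case: ifP.
- move=> p; case: (G _) => q qE; apply: path_homotopic_eq => s /=.
  by rewrite qE /= /mk_path /= fK.
- move=> p; case: (G _) => q qE; apply: path_homotopic_eq => s /=.
  by rewrite /mk_path /= qE /= gK.
Qed.


Section BasePoint.
Context {T : topologicalType}.
Local Notation path x y := {path (unitI R) from x to y in T}.

Lemma path_cat_homotopicl x y z (p q : path x y) (r : path y z) :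
  path_homotopic p q -> path_homotopic (path_cat p r) (path_cat q r).
Proof. by move=> pq; apply: path_cat_homotopic => //; exact: path_homotopic_refl. Qed.

Lemma path_cat_homotopicr x y z (p : path x y) (q r : path y z) :
  path_homotopic q r -> path_homotopic (path_cat p q) (path_cat p r).
Proof. by move=> qr; apply: path_cat_homotopic => //; exact: path_homotopic_refl. Qed.

Lemma path_catKl x y z (a : path x y) (b : path y x) (r : path x z) :
  path_homotopic (path_cat a b) (path_cst x) ->
  path_homotopic (path_cat a (path_cat b r)) r.
Proof.
move=> ab; apply: (path_homotopic_trans (path_catA _ _ _)).
exact: (path_homotopic_trans (path_cat_homotopicl _ ab) (path_cat1p r)).
Qed.

Definition conj_loop x y (a : path x y) (b : path y x) (p : path x x) : path y y :=
  path_cat b (path_cat p a).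

Lemma conj_loopK x y (a : path x y) (b : path y x) (p : path x x) :
  path_homotopic (path_cat a b) (path_cst x) ->
  path_homotopic (conj_loop b a (conj_loop a b p)) p.
Proof.
move=> ab.
apply: (path_homotopic_trans
  (path_cat_homotopicr _ (path_homotopic_sym (path_catA _ _ _)))).
apply: (path_homotopic_trans (path_catKl _ ab)).
apply: (path_homotopic_trans (path_homotopic_sym (path_catA _ _ _))).
exact: (path_homotopic_trans (path_cat_homotopicr _ ab) (path_catp1 p)).
Qed.

(** Conjugation by a path moves the base point. *)
Lemma isomorphic_pi1_path (x y : T) (a : path x y) :
  isomorphic_groups (pi1 R x) (pi1 R y).
Proof.
pose b := path_rev a; have ab := path_catpV a; have ba := path_catVp a.
apply: (@isomorphic_pi1 _ _ _ _ (conj_loop a b) (conj_loop b a)).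
- by move=> p q pq; apply: path_cat_homotopicr; exact: path_cat_homotopicl.
- by move=> p q pq; apply: path_cat_homotopicr; exact: path_cat_homotopicl.
- move=> p q; apply: path_homotopic_sym.
  apply: (path_homotopic_trans (path_homotopic_sym (path_catA _ _ _))).
  apply: path_cat_homotopicr.
  apply: (path_homotopic_trans (path_homotopic_sym (path_catA _ _ _))).
  apply: path_homotopic_trans (path_catA p q a).
  by apply: path_cat_homotopicr; exact: path_catKl.
- by move=> p; exact: conj_loopK.
- by move=> p; exact: conj_loopK.
Qed.

End BasePoint.
End GroupIso.

(** * Continuity of complex and matrix operations *)

Section ComplexTopology.
Context {R : realType}.
Local Notation C := (R[i]^o).

Lemma real_complex_continuous : continuous (fun r : R => (r%:C)%C : C).
Proof.
move=> r A /nbhs_ballP[e /= e0 eA]; apply/nbhs_ballP.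
have [er eE] : e \is Num.real /\ e = (complex.Re e)%:C%C.
  have er : e \is Num.real by apply: gtr0_real.
  by split => //; rewrite RRe_real.
exists (complex.Re e) => /=; first by move: e0; rewrite eE ltcR.
move=> s /= rs; apply: eA; rewrite /ball /= in rs *.
rewrite eE -rmorphB /= normc_def /= expr0n /= addr0 sqrtr_sqr.
by rewrite ltcR.
Qed.

Lemma mx_continuous (T : topologicalType) (X : topologicalType) m n
  (f : X -> 'M[T]_(m, n)) x :
  (forall i j, {for x, continuous (fun y => f y i j)}) -> {for x, continuous f}.
Proof.
move=> cf A [P Pn PA]; apply: (@filterS _ _ _ [set y | forall i j, P i j (f y i j)]).
  by move=> y Py; apply: PA.
apply: filter_forall => i; apply: filter_forall => j.
by apply: cf; exact: Pn.
Qed.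

Lemma mx_coord_continuous (T : topologicalType) m n i j :
  continuous (fun A : 'M[T]_(m, n) => A i j).
Proof.
move=> A B nB; pose P i' j' := if (i' == i) && (j' == j) then B else setT.
exists P => [i' j'|M /(_ i j)]; last by rewrite /P !eqxx.
by rewrite /P; case: andP => [[/eqP -> /eqP ->]//|_]; exact: filterT.
Qed.

Section Ops.
Context {X : topologicalType} (x : X).
Implicit Types f g : X -> C.

Lemma ctsD f g : {for x, continuous f} -> {for x, continuous g} ->
  {for x, continuous (fun y => f y + g y)}.
Proof.
move=> cf cg; have h : continuous (fun z : C * C => z.1 + z.2).
  exact: add_continuous.
exact: (@continuous2_cvg X C C C (nbhs x) _ f g (fun a b => a + b) _ _ (h (f x, g x)) cf cg).
Qed.

Lemma ctsN f : {for x, continuous f} -> {for x, continuous (fun y => - f y)}.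
Proof. by move=> cf; apply: cvgN. Qed.

Lemma ctsM f g : {for x, continuous f} -> {for x, continuous g} ->
  {for x, continuous (fun y => f y * g y)}.
Proof.
move=> cf cg; have h : continuous (fun z : C * C => z.1 * z.2).
  exact: mul_continuous.
exact: (@continuous2_cvg X C C C (nbhs x) _ f g (fun a b => a * b) _ _ (h (f x, g x)) cf cg).
Qed.

Lemma ctsV f : {for x, continuous f} -> f x != 0 ->
  {for x, continuous (fun y => (f y)^-1)}.
Proof. by move=> cf fx; apply: cvgV. Qed.

Lemma cts_sum (I : Type) (r : seq I) (P : pred I) (F : I -> X -> C) :
  (forall i, {for x, continuous (F i)}) ->
  {for x, continuous (fun y => \sum_(i <- r | P i) F i y)}.
Proof.
move=> cF; apply: cvg_big => [|i _]; last exact: cF.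
exact: add_continuous.
Qed.

Lemma cts_prod (I : Type) (r : seq I) (P : pred I) (F : I -> X -> C) :
  (forall i, {for x, continuous (F i)}) ->
  {for x, continuous (fun y => \prod_(i <- r | P i) F i y)}.
Proof.
move=> cF; apply: cvg_big => [|i _]; last exact: cF.
exact: mul_continuous.
Qed.

Lemma cts_cst (T : topologicalType) (c : T) : {for x, continuous (fun _ => c)}.
Proof. exact: cvg_cst. Qed.

Lemma cts_coord m n (f : X -> 'M[C]_(m, n)) i j :
  {for x, continuous f} -> {for x, continuous (fun y => f y i j)}.
Proof.
move=> cf; apply: (continuous_comp (f := f) (g := fun A : 'M[C]_(m, n) => A i j)).
  exact: cf.
exact: mx_coord_continuous.
Qed.

Lemma cts_mulmx m n p (f : X -> 'M[C]_(m, n)) (g : X -> 'M[C]_(n, p)) :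
  {for x, continuous f} -> {for x, continuous g} ->
  {for x, continuous (fun y => f y *m g y)}.
Proof.
move=> cf cg; apply: mx_continuous => i j.
have -> : (fun y => (f y *m g y) i j) = (fun y => \sum_k f y i k * g y k j).
  by apply/funext => y; rewrite mxE.
by apply: cts_sum => k; apply: ctsM; exact: cts_coord.
Qed.

Lemma cts_addmx m n (f g : X -> 'M[C]_(m, n)) :
  {for x, continuous f} -> {for x, continuous g} ->
  {for x, continuous (fun y => f y + g y)}.
Proof.
move=> cf cg; apply: mx_continuous => i j.
have -> : (fun y => (f y + g y) i j) = (fun y => f y i j + g y i j).
  by apply/funext => y; rewrite mxE.
by apply: ctsD; exact: cts_coord.
Qed.

Lemma cts_scalemx m n (c : X -> C) (f : X -> 'M[C]_(m, n)) :
  {for x, continuous c} -> {for x, continuous f} ->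
  {for x, continuous (fun y => c y *: f y)}.
Proof.
move=> cc cf; apply: mx_continuous => i j.
have -> : (fun y => (c y *: f y) i j) = (fun y => c y * f y i j).
  by apply/funext => y; rewrite mxE.
by apply: ctsM; [exact: cc|exact: cts_coord].
Qed.

Lemma cts_det n (f : X -> 'M[C]_n) :
  {for x, continuous f} -> {for x, continuous (fun y => \det (f y))}.
Proof.
move=> cf; rewrite /determinant; apply: cts_sum => s.
apply: ctsM; first exact: cts_cst.
by apply: cts_prod => i; exact: cts_coord.
Qed.

Lemma cts_adj n (f : X -> 'M[C]_n) :
  {for x, continuous f} -> {for x, continuous (fun y => \adj (f y))}.
Proof.
move=> cf; apply: mx_continuous => i j.
have -> : (fun y => (\adj (f y)) i j) = (fun y => cofactor (f y) j i).
  by apply/funext => y; rewrite mxE.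
rewrite /cofactor; apply: ctsM; first exact: cts_cst.
apply: cts_det; apply: mx_continuous => k l.
have -> : (fun y => row' j (col' i (f y)) k l) = (fun y => f y (lift j k) (lift i l)).
  by apply/funext => y; rewrite !mxE.
exact: cts_coord.
Qed.

End Ops.

Lemma near_open (X T : topologicalType) (f : X -> T) x (A : set T) :
  {for x, continuous f} -> open A -> A (f x) -> \forall y \near x, A (f y).
Proof. by move=> cf oA Ax; apply: cf; apply: open_nbhs_nbhs. Qed.

Lemma near_neq0 (X : topologicalType) (f : X -> C) x :
  {for x, continuous f} -> f x != 0 -> \forall y \near x, f y != 0.
Proof.
move=> cf fx; suff : nbhs (f x) [set c : C | c != 0] by move=> /cf.
apply/nbhs_ballP; exists `|f x| => /=; first by rewrite normr_gt0.
by move=> c; rewrite /ball /=; apply: contraTneq => ->; rewrite subr0 ltxx.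
Qed.

End ComplexTopology.

(** * Hyperplanes and their normal vectors *)

Section Hyperplanes.
Context {R : realType} {k : nat}.
Local Notation C := (R[i]^o).
Local Notation row := 'rV[C]_k.+1.
Local Notation col := 'cV[C]_k.+1.
Local Notation G := (Gr R k k.+1).
Local Notation FR := (@full_rank R k k.+1).
Implicit Types (f u : row) (v w : col) (V : G).

Definition pairing f v : C := (f *m v) 0 0.

Lemma pairing0P f v : f *m v = 0 <-> pairing f v = 0.
Proof.
rewrite /pairing; split=> [->|fv]; first by rewrite mxE.
by apply/matrixP => i j; rewrite !ord1 fv mxE.
Qed.

Lemma pairingDr f v w : pairing f (v + w) = pairing f v + pairing f w.
Proof. by rewrite /pairing mulmxDr mxE. Qed.

Lemma pairingZr f a v : pairing f (a *: v) = a * pairing f v.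
Proof. by rewrite /pairing -scalemxAr mxE. Qed.

Lemma pairingDl f u v : pairing (f + u) v = pairing f v + pairing u v.
Proof. by rewrite /pairing mulmxDl mxE. Qed.

Lemma pairingZl f a v : pairing (a *: f) v = a * pairing f v.
Proof. by rewrite /pairing -scalemxAl mxE. Qed.

Lemma pairing_delta i v : pairing (delta_mx 0 i) v = v i 0.
Proof. by rewrite /pairing -rowE mxE. Qed.

Lemma pairing_inj v w : (forall f, pairing f v = pairing f w) -> v = w.
Proof.
move=> vw; apply/matrixP => i j; rewrite ord1 -!pairing_delta; exact: vw.
Qed.

Lemma pairing_neq0 v : v != 0 -> exists f, pairing f v != 0.
Proof.
move=> v0; apply/not_existsP => H; case/eqP: v0; apply: pairing_inj => f.
have /negP := H f; rewrite negbK => /eqP ->.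
by rewrite /pairing mulmx0 mxE.
Qed.

Definition annihilates v V := forall u, u \in gr_space V -> pairing u v = 0.

Lemma mem_row_span m (A : 'M[C]_(m, k.+1)) u :
  (u \in row_span A) = (u <= A)%MS.
Proof.
apply/idP/submxP => [/coord_span ->|[c ->]].
  by rewrite row_comb; eexists.
have -> : c *m A = \sum_(j < m) c 0 j *: [tuple matrix.row j A | j < m]`_j.
  by rewrite row_comb; congr (_ *m _); apply/rowP => j; rewrite mxE.
by apply: memv_suml => j _; apply: memvZ; apply: memv_span; apply: mem_nth; rewrite size_tuple.
Qed.

Lemma gr_spaceE V u : (u \in gr_space V) = (u <= basis_mx V)%MS.
Proof. by rewrite /gr_space -row_span_basis_mx mem_row_span. Qed.

Lemma basis_mx_rank V : \rank (basis_mx V) = k.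
Proof.
by have /set_mem := basis_mx_full_rank V; rewrite /full_rank /= => /eqP.
Qed.

Lemma ex_annihilator V : exists v, v != 0 /\ annihilates v V.
Proof.
set A := basis_mx V; pose K := kermx A^T.
have K0 : nz_row K != 0.
  rewrite nz_row_eq0 -mxrank_eq0 mxrank_ker mxrank_tr basis_mx_rank.
  by rewrite subSnn.
exists (nz_row K)^T; split.
  by apply: contra K0 => /eqP/(congr1 trmx); rewrite trmxK trmx0 => /eqP.
move=> u; rewrite gr_spaceE => /submxP[D ->]; apply/pairing0P.
rewrite -mulmxA; apply: trmx_inj.
have /sub_kermxP KA : (nz_row K <= K)%MS := nz_row_sub K.
by rewrite -/A [LHS]trmx_mul trmx_mul trmxK KA mul0mx trmx0.
Qed.

(** Only the line of this normal vector is canonical; [normal] rescales it. *)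
Definition covec V : col := sval (cid (ex_annihilator V)).

Lemma covec_neq0 V : covec V != 0.
Proof. by rewrite /covec; case: cid => v []. Qed.

Lemma covec_annihilates V : annihilates (covec V) V.
Proof. by rewrite /covec; case: cid => v []. Qed.

(** Both sides are subspaces of dimension [k], one included in the other. *)
Lemma mem_annihilated V v u : v != 0 -> annihilates v V ->
  (u \in gr_space V) = (pairing u v == 0).
Proof.
move=> v0 vV; apply/idP/eqP => [/vV //|/pairing0P uv].
rewrite gr_spaceE; set A := basis_mx V.
have Av : (A <= kermx v)%MS.
  apply/sub_kermxP/row_matrixP => i; rewrite row_mul row0.
  by apply/pairing0P/vV; rewrite gr_spaceE row_sub.
have rv : \rank v = 1%N.
  by apply/eqP; rewrite eqn_leq rank_leq_col lt0n mxrank_eq0.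
have : (kermx v <= A)%MS.
  by rewrite -(geq_leqif (mxrank_leqif_sup Av)) mxrank_ker rv basis_mx_rank subn1.
by apply: submx_trans; apply/sub_kermxP.
Qed.

Lemma annihilated_inj V W v : v != 0 -> annihilates v V -> annihilates v W ->
  V = W.
Proof.
move=> v0 vV vW; apply: (@val_inj _ _ {V : {vspace row} | \dim V == k} V W).
apply/vspaceP => u.
by rewrite [LHS](mem_annihilated u v0 vV) [RHS](mem_annihilated u v0 vW).
Qed.

(** Every [u] differs by a multiple of [f] from a vector of [V], and so is determined
    on [v] and on [w] by the same number. *)
Lemma annihilator_uniq V f v w : annihilates v V -> annihilates w V ->
  pairing f v = 1 -> pairing f w = 1 -> v = w.
Proof.
move=> vV wV fv fw; have v0 : v != 0.
  apply/eqP => v0; move: fv; rewrite v0 /pairing mulmx0 mxE => /esym/eqP.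
  by rewrite oner_eq0.
apply: pairing_inj => u.
have : u + (- pairing u v) *: f \in gr_space V.
  by rewrite (mem_annihilated _ v0 vV) pairingDl pairingZl fv mulr1 subrr.
by move=> /wV; rewrite pairingDl pairingZl fw mulr1 => /eqP; rewrite subr_eq0 => /eqP ->.
Qed.

(** The hyperplanes that do not contain [f]: the affine chart of the Grassmannian that
    belongs to [f]. *)
Definition transversal f : set G := [set V | pairing f (covec V) != 0].

Definition normal f V : col := (pairing f (covec V))^-1 *: covec V.

Lemma pairing_normal f V : transversal f V -> pairing f (normal f V) = 1.
Proof. by move=> fV; rewrite /normal pairingZr mulVf. Qed.

Lemma normal_annihilates f V : annihilates (normal f V) V.
Proof. by move=> u uV; rewrite /normal pairingZr (covec_annihilates uV) mulr0. Qed.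

Lemma normalE f V v : annihilates v V -> pairing f v = 1 ->
  transversal f V /\ normal f V = v.
Proof.
move=> vV fv; have fV : transversal f V.
  apply/eqP => fc.
  have : f \in gr_space V.
    by rewrite (mem_annihilated _ (covec_neq0 V) (@covec_annihilates V)) fc.
  by move=> /vV/eqP; rewrite fv oner_eq0.
split=> //; apply: (@annihilator_uniq V f) => //; last exact: pairing_normal.
exact: normal_annihilates.
Qed.

Lemma normal_inj f V W : transversal f V -> normal f V = normal f W -> V = W.
Proof.
move=> fV VW; apply: (@annihilated_inj _ _ (normal f V)).
- by rewrite scaler_eq0 negb_or invr_eq0 fV covec_neq0.
- exact: normal_annihilates.
- by rewrite VW; exact: normal_annihilates.
Qed.


(** The functionals are restricted to the moment curve.  Evaluating one of them on [v]
    evaluates at [t] the polynomial with coefficients [v], and its coordinate of index 0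
    is 1, which makes [perp] explicit. *)
Definition moment (t : C) : row := \row_j t ^+ j.

Lemma moment0 t : moment t 0 0 = 1.
Proof. by rewrite mxE expr0. Qed.

Definition bordered f (A : 'M[C]_(k, k.+1)) : 'M[C]_(1 + k) := col_mx f A.

Lemma span_of_pi (A : set_type FR) u :
  (u \in gr_space (\pi_G A)%qT) = (u <= \val A)%MS.
Proof. by rewrite unlock -mem_row_span. Qed.

(** If [f] is not in the row space of [A], adding it to the rows of [A] gives a basis. *)
Lemma bordered_unit f (A : set_type FR) :
  (bordered f (\val A) \in unitmx) = (pairing f (covec (\pi_G A)%qT) != 0).
Proof.
set w := covec _; set S := bordered f _.
have Aw : \val A *m w = 0.
  apply/row_matrixP => i; rewrite row_mul row0.
  by apply/pairing0P/covec_annihilates; rewrite span_of_pi row_sub.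
have Sw : S *m w = col_mx (f *m w) 0 by rewrite mul_col_mx Aw.
apply/idP/idP => [uS|fw].
  apply/eqP => /pairing0P fw; move: Sw; rewrite fw col_mx0 => Sw.
  by have := covec_neq0 (\pi_G A)%qT; rewrite -[covec _](mulKmx uS) Sw mulmx0 eqxx.
rewrite -row_free_unit; apply/inj_row_free => c.
rewrite -[c]hsubmxK /S /bordered mul_row_col => cS.
have c0 : lsubmx c = 0.
  have : (lsubmx c *m f + rsubmx c *m \val A) *m w = 0 by rewrite cS mul0mx.
  rewrite mulmxDl -!mulmxA Aw mulmx0 addr0 => /matrixP/(_ 0 0).
  rewrite [RHS]mxE mxE big_ord1 => /eqP.
  rewrite mulf_eq0 -/(pairing f w) (negPf fw) orbF => /eqP c00.
  by apply/matrixP => i j; rewrite !ord1 c00 mxE.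
move: cS; rewrite c0 mul0mx add0r => cA.
have /set_mem := valP A; rewrite /full_rank /= => /row_freeP[B AB].
have -> : rsubmx c = 0 by rewrite -[rsubmx c]mulmx1 -AB mulmxA cA mul0mx.
by rewrite row_mx0.
Qed.

(** The normal vector solves a square linear system, so Cramer's rule expresses it
    through the entries of [A]. *)
Lemma normal_pi f (A : set_type FR) : transversal f (\pi_G A)%qT ->
  normal f (\pi_G A)%qT = (\det (bordered f (\val A)))^-1 *:
    matrix.col 0 (\adj (bordered f (\val A))).
Proof.
move=> fA; set S := bordered _ _; set w := normal _ _.
have uS : S \in unitmx by rewrite bordered_unit.
have Aw : \val A *m w = 0.
  apply/row_matrixP => i; rewrite row_mul row0.
  by apply/pairing0P; apply: (@normal_annihilates f (\pi_G A)%qT); rewrite span_of_pi row_sub.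
have Sw : S *m w = matrix.col 0 1%:M.
  rewrite mul_col_mx Aw; apply/matrixP => i j; rewrite ord1 [RHS]mxE.
  have fw : pairing f w = 1 := pairing_normal fA.
  rewrite mxE; case: splitP => [i0|i1] iE.
    by rewrite ord1 in iE *; rewrite -/(pairing f w) fw mxE -val_eqE /= iE.
  by rewrite !mxE -val_eqE /= iE.
by rewrite -[LHS](mulKmx uS) Sw !colE mul1mx /invmx uS -scalemxAl.
Qed.

(** Openness in the quotient is openness of a set of matrices, where the normal vector
    is a rational function of the entries. *)
Lemma open_normal f (W : set col) : open W ->
  open (transversal f `&` normal f @^-1` W).
Proof.
move=> oW; rewrite /open /= /quotient_open openE => A /= [fA nA].
pose S (B : set_type FR) := bordered f (\val B).
have cval : {for A, continuous (fun B : set_type FR => \val B)}.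
  exact: initial_continuous.
have cS : {for A, continuous S}.
  apply: mx_continuous => i j.
  have -> : (fun B => fun_of_matrix (S B) i j) =
     (fun B => match fintype.split i with inl i0 => f i0 j | inr i1 => fun_of_matrix (\val B) i1 j end).
    by apply/funext => B; rewrite /S /bordered mxE.
  by case: (fintype.split i) => i'; [exact: cts_cst|exact: cts_coord].
have dA : \det (S A) != 0 by rewrite -unitfE -unitmxE bordered_unit.
have cdet := cts_det cS.
pose g B := (\det (S B))^-1 *: matrix.col 0 (\adj (S B)).
have cg : {for A, continuous g}.
  apply: cts_scalemx; first by apply: ctsV.
  apply: mx_continuous => i j.
  have -> : (fun B => matrix.col 0 (\adj (S B)) i j) = (fun B => \adj (S B) i 0).
    by apply/funext => B; rewrite mxE.
  by apply: cts_coord; exact: cts_adj.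
have gA : W (g A) by rewrite /g -normal_pi.
have near_d := near_neq0 cdet dA.
have near_W : \forall B \near A, W (g B).
  by apply: cg; apply: open_nbhs_nbhs; split.
apply: filterS2 near_d near_W => B dB WB.
have fB : transversal f (\pi_G B)%qT.
  by rewrite /transversal /= -bordered_unit unitmxE unitfE.
by split; [exact: fB|rewrite /preimage /= (normal_pi fB)].
Qed.

Lemma open_transversal f : open (transversal f).
Proof. by rewrite -[transversal f]setIT -(preimage_setT (normal f)); apply: open_normal; exact: openT. Qed.

Lemma normal_continuous f V : transversal f V -> {for V, continuous (normal f)}.
Proof.
move=> fV A; rewrite nbhsE => -[W [oW WV] WA].
suff : \forall U \near V, transversal f U /\ W (normal f U).
  by apply: filterS => U [_ /WA].
by apply: open_nbhs_nbhs; split; [exact: open_normal|split].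
Qed.

(** The rows are the projections along [moment t] of the standard basis vectors of
    positive index; they span the orthogonal of [v] as soon as [moment t] is 1 on [v],
    but are independent for all [v], so that [perp] is defined everywhere. *)
Definition perp_mx (t : C) v : 'M[C]_(k, k.+1) :=
  \matrix_(i, j) ((j == lift ord0 i)%:R - v (lift ord0 i) 0 * moment t 0 j).

Lemma perp_mx_full_rank t v : perp_mx t v \in FR.
Proof.
apply/mem_set; rewrite /full_rank /=; apply/inj_row_free => c cA.
pose s := \sum_i c 0 i * v (lift ord0 i) 0.
have coef j : \sum_i c 0 i * (j == lift ord0 i)%:R = s * moment t 0 j.
  have /matrixP/(_ 0 j) := cA; rewrite [RHS]mxE mxE => /eqP.
  under eq_bigr do rewrite mxE mulrBr mulrA.
  by rewrite sumrB -mulr_suml subr_eq0 => /eqP.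
have s0 : s = 0.
  rewrite -[s]mulr1 -(moment0 t) -coef big1// => i _.
  by rewrite (negPf (neq_lift _ _)) mulr0.
apply/rowP => j; have := coef (lift ord0 j); rewrite s0 mul0r.
rewrite (bigD1 j)//= eqxx mulr1 big1 ?addr0 => [->|i ij]; first by rewrite mxE.
by rewrite (inj_eq lift_inj) eq_sym (negPf ij) mulr0.
Qed.

Definition perp t v : G :=
  (\pi_G (exist (fun A => A \in FR) _ (perp_mx_full_rank t v)))%qT.

Lemma perp_continuous t : continuous (perp t).
Proof.
pose lift_perp v : set_type FR :=
  exist (fun A => A \in FR) _ (perp_mx_full_rank t v).
suff cl : continuous lift_perp.
  move=> v; apply: (@continuous_comp _ _ _ lift_perp (\pi_G)%qT); first exact: cl.
  exact: pi_continuous.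
apply/continuous_comp_initial.
have -> : set_val \o lift_perp = perp_mx t by exact/funext.
move=> v; apply: mx_continuous => i j.
have -> : (fun w : col => (perp_mx t w) i j) =
   (fun w : col => (j == lift ord0 i)%:R + - (w (lift ord0 i) 0 * moment t 0 j)).
  by apply/funext => w; rewrite mxE.
apply: ctsD; first exact: cts_cst.
apply: ctsN; apply: ctsM; last exact: cts_cst.
by apply: cts_coord => A.
Qed.

Lemma annihilates_perp t v : pairing (moment t) v = 1 -> annihilates v (perp t v).
Proof.
move=> tv u; rewrite span_of_pi => /submxP[D ->]; apply/pairing0P.
rewrite -mulmxA (_ : _ *m v = 0) ?mulmx0//; apply/matrixP => i j.
rewrite ord1 [RHS]mxE mxE; under eq_bigr do rewrite mxE mulrBl -mulrA.
rewrite sumrB -mulr_sumr (bigD1 (lift ord0 i))//= eqxx mul1r big1 ?addr0.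
  by move: tv; rewrite /pairing mxE => ->; rewrite mulr1 subrr.
by move=> j' /negPf ->; rewrite mul0r.
Qed.

Lemma perpK t v : pairing (moment t) v = 1 ->
  transversal (moment t) (perp t v) /\ normal (moment t) (perp t v) = v.
Proof. by move=> tv; apply: normalE => //; exact: annihilates_perp. Qed.

Lemma normalK t V : transversal (moment t) V -> perp t (normal (moment t) V) = V.
Proof.
move=> tV; have [tH HE] := perpK (pairing_normal tV).
exact: normal_inj HE.
Qed.

End Hyperplanes.

(** * Avoiding the roots of a polynomial *)

Section Generic.
Context {R : realType}.
Local Notation C := (R[i]^o).

Lemma poly_nonroot (p : {poly C}) : p != 0 -> exists z, p.[z] != 0.
Proof.
move=> p0; apply/not_existsP => H.
have allr : all (root p) [seq (i%:R : C) | i <- iota 0 (size p)].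
  apply/allP => z _; have /negP := H z; rewrite negbK => ?; exact/rootP/eqP.
have uniqr : uniq [seq (i%:R : C) | i <- iota 0 (size p)].
  by rewrite map_inj_uniq ?iota_uniq// => a b /eqP; rewrite eqr_nat => /eqP.
by have := max_poly_roots p0 allr uniqr; rewrite size_map size_iota ltnn.
Qed.

(** The arcs Im z = y Re z (1 - Re z), for natural y, meet only at 0 and 1, so a polynomial
    that vanishes somewhere on each arc would have too many roots. *)
Lemma avoiding_path (p : {poly C}) : p.[0] != 0 -> p.[1] != 0 ->
  exists g : unitI R -> C,
    [/\ continuous g, g zero = 0, g one = 1 & forall s, p.[g s] != 0].
Proof.
move=> p0 p1.
pose arc (y : nat) (s : R) : C :=
  (s%:C + Complex 0 1 * (y%:R * (s * (1 - s)))%:C)%C.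
have ReA y s : complex.Re (arc y s) = s by rewrite /arc; simpc.
have ImA y s : complex.Im (arc y s) = y%:R * (s * (1 - s)) by rewrite /arc; simpc.
have arc0 y : arc y 0 = 0 by apply/eqP; rewrite eq_complex ReA ImA /= mul0r mulr0 !eqxx.
have arc1 y : arc y 1 = 1 by apply/eqP; rewrite eq_complex ReA ImA /= subrr !mulr0 !eqxx.
have [y yP] : exists y : nat, forall s : unitI R, p.[arc y (ival s)] != 0.
  apply/not_existsP => H.
  (* One root on each of the first [size p] arcs is one root too many. *)
  have {}H y : exists s : unitI R, p.[arc y (ival s)] = 0.
    by have /existsNP[s /negP] := H y; rewrite negbK => /eqP; exists s.
  pose sg y := sval (cid (H y)).
  have sgP y : p.[arc y (ival (sg y))] = 0 by rewrite /sg; case: cid.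
  have sg_prod y : ival (sg y) * (1 - ival (sg y)) != 0.
    rewrite mulf_neq0//; apply/eqP => sgy; have := sgP y.
      by rewrite sgy arc0 => /eqP; rewrite (negPf p0).
    have -> : ival (sg y) = 1 by apply/esym/eqP; rewrite -subr_eq0 sgy.
    by rewrite arc1 => /eqP; rewrite (negPf p1).
  pose rs := [seq arc y (ival (sg y)) | y <- iota 0 (size p)].
  have allr : all (root p) rs.
    by apply/allP => _ /mapP[y _ ->]; apply/rootP; exact: sgP.
  have uniqr : uniq rs.
    rewrite map_inj_uniq ?iota_uniq// => a b ab.
    have sab : ival (sg a) = ival (sg b) by rewrite -[LHS](ReA a) ab ReA.
    have := congr1 (@complex.Im R) ab; rewrite !ImA sab; move/(mulIf (sg_prod b)).
    by move/eqP; rewrite eqr_nat => /eqP.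
  have pn0 : p != 0 by apply: contraNneq p0 => ->; rewrite horner0.
  by have := max_poly_roots pn0 allr uniqr; rewrite size_map size_iota ltnn.
exists (fun s => arc y (ival s)); split => //.
- have cC (f : unitI R -> R) : continuous f ->
      continuous (fun s => (f s)%:C%C : C).
    move=> cf s; apply: (@continuous_comp _ _ _ f (fun r : R => r%:C%C : C)).
      exact: cf.
    exact: real_complex_continuous.
  move=> s; apply: (@ctsD _ _ s (fun s => (ival s)%:C%C : C)
    (fun s => (Complex 0 1 : C) * ((y%:R * (ival s * (1 - ival s)))%:C%C : C))).
    by apply: cC; exact: val_unitI_continuous.
  apply: ctsM; first exact: cts_cst.
  apply: (cC (fun s => y%:R * (ival s * (1 - ival s)))) => {}s.
  apply: (@continuous_comp _ _ _ (@ival R) (fun r : R => y%:R * (r * (1 - r)))).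
    exact: val_unitI_continuous.
  apply: cvgM; first exact: cvg_cst.
  by apply: cvgM; [exact: cvg_id|apply: cvgB; [exact: cvg_cst|exact: cvg_id]].
- by rewrite val_zero.
- by rewrite val_one.
Qed.

(** The values are those of nonzero polynomials at [t], and their product has a nonroot. *)
Lemma moment_nonzero k (J : finType) (P : pred J) (v : J -> 'cV[C]_k.+1) :
  (forall j, P j -> v j != 0) ->
  exists t, forall j, P j -> pairing (moment t) (v j) != 0.
Proof.
move=> v0; pose p j : {poly C} := \poly_(i < k.+1) v j (inord i) 0.
have pE j t : (p j).[t] = pairing (moment t) (v j).
  rewrite horner_poly /pairing mxE; apply: eq_bigr => i _.
  by rewrite mxE inord_val mulrC.
have [t tP] : exists t, (\prod_(j | P j) p j).[t] != 0.
  apply: poly_nonroot; apply/prodf_neq0 => j /v0; apply: contra => /eqP pj.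
  apply/eqP/matrixP => i l; rewrite ord1 [RHS]mxE.
  by have := coef_poly k.+1 (fun i => v j (inord i) 0) i; rewrite -/(p j) pj coef0 ltn_ord inord_val.
exists t => j Pj; rewrite -pE; move: tP.
by rewrite horner_prod => /prodf_neq0/(_ j Pj).
Qed.

End Generic.

(** * Charts of the configuration space *)

Lemma ptws_continuous (W T : topologicalType) (I : Type) (F : W -> I -> T) :
  (forall a, continuous (F ^~ a)) ->
  continuous (F : W -> prod_topology (fun _ : I => T)).
Proof.
move=> Fc w; apply/cvg_sup => a U [V] [[B oB <-] BFw BU].
suff : nbhs w (F ^~ a @^-1` B) by apply: filterS => w' Bw'; exact: BU.
by apply: Fc; apply: open_nbhs_nbhs.
Qed.

Section Configurations.
Context {R : realType} {h i k : nat}.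
Local Notation C := (R[i]^o).
Local Notation row := 'rV[C]_k.+1.
Local Notation col := 'cV[C]_k.+1.
Local Notation G := (Gr R k k.+1).
Local Notation X := (config_dim R h i k k.+1).
Implicit Types (x y : X) (a b : 'I_h) (s t : C).

Definition place x a : G := \val x a.

Lemma place_inj x : injective (place x).
Proof. by rewrite /place; case: x => x /= /set_mem[]. Qed.

Lemma place_eq x y : (forall a, place x a = place y a) -> x = y.
Proof. by move=> xy; apply: val_inj; apply/funext. Qed.

Lemma place_continuous a : continuous (place ^~ a).
Proof.
move=> x; apply: (@continuous_comp _ _ _ (fun x : X => \val x)
  (fun p : prod_topology (fun _ : 'I_h => G) => p a)).
  exact: initial_continuous.
exact: (@proj_continuous _ (fun _ : 'I_h => G) a).
Qed.

(** If two hyperplanes are distinct then their sum is not one of them, and so it is the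
    whole space. *)
Lemma dim_sum_gr (p : 'I_h -> G) : injective p ->
  \dim (\sum_(a < h) gr_space (p a))%VS =
    if h is 0 then 0%N else if h is 1 then k else k.+1.
Proof.
case: h p => [|[|h']] p pinj.
- by rewrite big_ord0 dimv0.
- by rewrite big_ord1; exact/eqP/(svalP (p ord0 : subspaces R k k.+1)).
set S := (\sum_(a < _) _)%VS.
have sub (a : 'I_h'.+2) : (gr_space (p a) <= S)%VS by exact: (sumv_sup a).
have dimp (a : 'I_h'.+2) : \dim (gr_space (p a)) = k.
  exact/eqP/(svalP (p a : subspaces R k k.+1)).
apply/eqP; rewrite eqn_leq; apply/andP; split.
  by have := dimvS (subvf S); rewrite dimvf /dim /= mul1n.
rewrite ltnNge; apply/negP => Sk.
have pS (a : 'I_h'.+2) : gr_space (p a) = S.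
  by apply/eqP; rewrite eqEdim sub dimp.
have : p ord0 = p (lift ord0 ord0).
  apply: (@val_inj _ _ {V : {vspace row} | \dim V == k}).
  by rewrite -[LHS]/(gr_space _) -[RHS]/(gr_space _) !pS.
by move/pinj/eqP.
Qed.

(** The dimension condition holds for the configuration [x], hence for all families of
    distinct hyperplanes. *)
Lemma config_of x (p : 'I_h -> G) : injective p ->
  (p : prod_topology (fun _ : 'I_h => G)) \in
  [set z : prod_topology (fun _ : 'I_h => G) |
    injective z /\ \dim (\sum_(a < h) gr_space (z a))%VS = i].
Proof.
move=> pinj; apply/mem_set; split => //.
have [/dim_sum_gr xd <-] := set_mem (valP x).
by rewrite dim_sum_gr.
Qed.

Lemma config_family x (W : topologicalType) (F : W -> 'I_h -> G) :
  (forall w, injective (F w)) -> (forall a, continuous (F ^~ a)) ->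
  exists2 g : W -> X, continuous g & forall w a, place (g w) a = F w a.
Proof.
move=> Finj Fc.
pose g w : X := exist _ (F w : prod_topology (fun _ : 'I_h => G)) (config_of x (Finj w)).
exists g => //; apply/continuous_comp_initial.
have -> : set_val \o g = (F : W -> prod_topology (fun _ : 'I_h => G)) by exact/funext.
exact: ptws_continuous.
Qed.

(** The coordinate of a hyperplane in the affine chart of [moment s] along [moment t]. *)
Definition coord s t (V : G) : C := pairing (moment t) (normal (moment s) V).

(** Distinct coordinates, and not merely distinct hyperplanes: this is what the
    deformations of [chart_inessential] can preserve. *)
Definition chart s t : set X := [set x |
  (forall a, transversal (moment s) (place x a)) /\
  (forall a b, a != b -> coord s t (place x a) != coord s t (place x b))].

Lemma pairing_continuous (f : row) : continuous (pairing f).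
Proof.
by move=> v; apply: cts_coord; apply: cts_mulmx => [|A]; [exact: cts_cst|].
Qed.

Lemma normal_place_continuous (W : topologicalType) (g : W -> X) s a w :
  {for w, continuous g} -> transversal (moment s) (place (g w) a) ->
  {for w, continuous (fun w' => normal (moment s) (place (g w') a))}.
Proof.
move=> cg tw; apply: (@continuous_comp _ _ _ (fun w' => place (g w') a)
   (normal (moment s))); last exact: normal_continuous.
apply: (@continuous_comp _ _ _ g (place ^~ a)); first exact: cg.
exact: place_continuous.
Qed.

Lemma chart_open s t : open (chart s t).
Proof.
rewrite openE => x [tx cx].
have Fx : Filter (nbhs x) := nbhs_filter x.
have ct a : {for x, continuous (fun y => coord s t (place y a))}.
  apply: (@continuous_comp _ _ _ (fun y => normal (moment s) (place y a))
    (pairing (moment t))); last exact: pairing_continuous.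
  exact: (@normal_place_continuous _ id).
have near_t : \forall y \near x, forall a, transversal (moment s) (place y a).
  apply: (@filter_forall _ _ (fun a y => transversal _ (place y a)) _ Fx) => a.
  exact: (near_open (@place_continuous a x) (@open_transversal _ _ _) (tx a)).
have near_c : \forall y \near x, forall a b, a != b ->
    coord s t (place y a) != coord s t (place y b).
  pose P a b y := a != b -> coord s t (place y a) != coord s t (place y b).
  apply: (@filter_forall _ _ (fun a y => forall b, P a b y) _ Fx) => a.
  apply: (@filter_forall _ _ (P a) _ Fx) => b; rewrite /P.
  have [->|ab] := eqVneq a b; first exact: nearW.
  have : \forall y \near x,
      coord s t (place y a) + - coord s t (place y b) != 0.
    apply: near_neq0; last by rewrite subr_eq0; exact: cx.
    by apply: ctsD; [exact: ct|apply: ctsN; exact: ct].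
  by apply: filterS => y; rewrite subr_eq0.
by apply: (filterS2 Fx _ near_t near_c) => y.
Qed.

Lemma eq_ratio (a b c d : C) : b != 0 -> d != 0 ->
  (b^-1 * a == d^-1 * c) = (d * a - b * c == 0).
Proof.
have H (F : fieldType) (a' b' c' d' : F) : b' != 0 -> d' != 0 ->
    (b'^-1 * a' == d'^-1 * c') = (d' * a' - b' * c' == 0).
  by move=> b0 d0; rewrite subr_eq0 !(mulrC _^-1) eqr_div// mulrC (mulrC b').
exact: (H R[i]).
Qed.

(** The conditions of [chart] with denominators cleared: polynomial in the vectors [v],
    and meaningful for normal vectors of any length. *)
Definition generic s t (v : 'I_h -> col) :=
  (forall a, pairing (moment s) (v a) != 0) /\
  (forall a b, a != b ->
    pairing (moment s) (v b) * pairing (moment t) (v a) -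
    pairing (moment s) (v a) * pairing (moment t) (v b) != 0).

Lemma chartE s t x (v : 'I_h -> col) :
  (forall a, v a != 0) -> (forall a, annihilates (v a) (place x a)) ->
  generic s t v <-> chart s t x.
Proof.
move=> v0 vx.
pose f : row := moment s.
have nE a : pairing f (v a) != 0 ->
    transversal f (place x a) /\
    normal f (place x a) = (pairing f (v a))^-1 *: v a.
  move=> fv; apply: normalE; last by rewrite pairingZr mulVf.
  by move=> u ux; rewrite pairingZr (vx a u ux) mulr0.
have vf a : transversal f (place x a) -> pairing f (v a) != 0.
  rewrite /transversal /= => fc; apply/eqP => fv; case/eqP: fc.
  have : f \in gr_space (place x a).
    by rewrite (mem_annihilated _ (v0 a) (vx a)) fv.
  exact: covec_annihilates.
have cE a b : pairing f (v a) != 0 -> pairing f (v b) != 0 ->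
   (coord s t (place x a) == coord s t (place x b)) =
   (pairing f (v b) * pairing (moment t) (v a) -
    pairing f (v a) * pairing (moment t) (v b) == 0).
  move=> fa fb; have [_ na] := nE a fa; have [_ nb] := nE b fb.
  by rewrite /coord na nb !pairingZr; exact: eq_ratio.
split=> [[g1 g2]|[c1 c2]]; split=> [a|a b ab].
- by have [] := nE a (g1 a).
- by rewrite cE ?g1//; exact: g2.
- exact/vf/c1.
- by rewrite -cE; [exact: c2|exact/vf/c1|exact/vf/c1].
Qed.

(** First [s] is chosen so that [moment s] is nonzero on all normals, then [t] so that
    [moment t] is nonzero on the combinations of two normals killed by [moment s]. *)
Lemma common_chart x y : exists s t, chart s t x /\ chart s t y.
Proof.
pose z (e : bool) := if e then x else y.
pose v (e : bool) a := covec (place (z e) a).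
have v0 e a : v e a != 0 by exact: covec_neq0.
have vz e a : annihilates (v e a) (place (z e) a) by exact: covec_annihilates.
have [s sP] := @moment_nonzero R k _ predT (fun ea : bool * 'I_h => v ea.1 ea.2)
  (fun ea _ => v0 ea.1 ea.2).
pose f : row := moment s.
have {}sP e a : pairing f (v e a) != 0 by exact: (sP (e, a)).
(* Killed by [f], and nonzero because the two normals are not proportional. *)
pose w (j : bool * ('I_h * 'I_h)) : col := let: (e, (a, b)) := j in
  pairing f (v e b) *: v e a + (- pairing f (v e a)) *: v e b.
have w0 j : j.2.1 != j.2.2 -> w j != 0.
  case: j => e [a b] /= ab; apply/eqP => w0; case/eqP: ab.
  apply: (@place_inj (z e)).
  apply: (@annihilated_inj _ _ _ _ (v e a)) => //.
  have -> : v e a = (pairing f (v e b))^-1 *: (pairing f (v e a) *: v e b).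
    move/eqP: w0; rewrite scaleNr subr_eq0 => /eqP <-.
    by rewrite scalerA mulVf ?scale1r.
  by move=> u ub; rewrite !pairingZr (vz e b u ub) !mulr0.
have [t tP] := @moment_nonzero R k _ (fun j => j.2.1 != j.2.2) w w0.
exists s, t.
have gz e : chart s t (z e).
  apply/(@chartE s t (z e) (v e)) => //; split=> [//|a b ab].
  have := tP (e, (a, b)) ab; by rewrite /w pairingDr !pairingZr mulNr.
by split; [exact: (gz true)|exact: (gz false)].
Qed.

End Configurations.

(** * Intersections of two charts are path connected *)

Section Charts.
Context {R : realType} {h i k : nat}.
Local Notation C := (R[i]^o).
Local Notation row := 'rV[C]_k.+1.
Local Notation col := 'cV[C]_k.+1.
Local Notation G := (Gr R k k.+1).
Local Notation X := (config_dim R h i k k.+1).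
Implicit Types (x y : X) (a b : 'I_h) (s t : C).

Lemma generic_perp_inj s t (v : 'I_h -> col) :
  (forall a, pairing (moment s) (v a) = 1) -> generic s t v ->
  injective (fun a => perp s (v a)).
Proof.
move=> v1 [_ g] a b ab; apply/eqP/contraT => /g.
have [_ <-] := perpK (v1 a); have [_ <-] := perpK (v1 b).
by rewrite ab subrr eqxx.
Qed.

Lemma pairing1_neq0 (f : row) (v : col) : pairing f v = 1 -> v != 0.
Proof.
move=> fv; apply/eqP => v0; move: fv; rewrite v0 /pairing mulmx0 mxE.
by move/esym/eqP; rewrite oner_eq0.
Qed.

Lemma pairingBr (f : row) (v w : col) :
  pairing f (v - w) = pairing f v - pairing f w.
Proof. by rewrite /pairing mulmxBr !mxE. Qed.

Section Line.
Context (v w : 'I_h -> col).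

Definition line (z : C) a : col := v a + z *: (w a - v a).

Lemma line0 : line 0 = v.
Proof. by apply/funext => a; rewrite /line scale0r addr0. Qed.

Lemma line1 : line 1 = w.
Proof. by apply/funext => a; rewrite /line scale1r addrC subrK. Qed.

Lemma pairing_line f z a : pairing f (line z a) =
  pairing f (v a) + z * (pairing f (w a) - pairing f (v a)).
Proof. by rewrite /line pairingDr pairingZr pairingBr. Qed.

Lemma pairing_line1 f z a :
  pairing f (v a) = 1 -> pairing f (w a) = 1 -> pairing f (line z a) = 1.
Proof. by move=> va wa; rewrite pairing_line va wa subrr mulr0 addr0. Qed.

Definition line_poly (f : row) a : {poly C} :=
  (pairing f (v a))%:P + 'X * (pairing f (w a - v a))%:P.

Lemma line_polyE f a z : (line_poly f a).[z] = pairing f (line z a).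
Proof.
rewrite /line [RHS]pairingDr [in RHS]pairingZr /line_poly hornerD hornerC.
by rewrite hornerM hornerX hornerC.
Qed.

Lemma horner_cross (F : comNzRingType) (p q r u : {poly F}) z :
  (p * q - r * u).[z] = p.[z] * q.[z] - r.[z] * u.[z].
Proof. by rewrite hornerD hornerN !hornerM. Qed.

Lemma horner_crossC (p q r u : {poly C}) (z : C) :
  (p * q - r * u).[z] = p.[z] * q.[z] - r.[z] * u.[z].
Proof. exact: horner_cross. Qed.

Lemma horner_mul_neq0 (p q : {poly C}) (z : C) :
  (p * q).[z] != 0 <-> p.[z] != 0 /\ q.[z] != 0.
Proof.
have H (F : fieldType) (p' q' : {poly F}) (z' : F) :
    (p' * q').[z'] != 0 <-> p'.[z'] != 0 /\ q'.[z'] != 0.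
  by rewrite hornerM mulf_eq0 negb_or; split=> /andP.
exact: (H R[i]).
Qed.

Definition cross_poly (f g : row) a b : {poly C} :=
  line_poly f b * line_poly g a - line_poly f a * line_poly g b.

Lemma cross_polyE f g a b z : (cross_poly f g a b).[z] =
  pairing f (line z b) * pairing g (line z a) -
  pairing f (line z a) * pairing g (line z b).
Proof.
have E f' a' := line_polyE f' a' z.
exact: (etrans (horner_crossC _ _ _ _ z)
  (congr2 (fun c d : C => c - d) (congr2 *%R (E f b) (E g a))
                                 (congr2 *%R (E f a) (E g b)))).
Qed.

Definition generic_poly s t : {poly C} :=
  (\prod_a line_poly (moment s) a) *
  \prod_(ab : 'I_h * 'I_h | ab.1 != ab.2)
    cross_poly (moment s) (moment t) ab.1 ab.2.

Lemma generic_polyP s t z :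
  (generic_poly s t).[z] != 0 <-> generic s t (line z).
Proof.
rewrite horner_mul_neq0 !horner_prod; split.
  move=> [/prodf_neq0 g1 /prodf_neq0 g2]; split=> [a|a b ab].
    by rewrite -line_polyE; exact: g1.
  by have := g2 (a, b) ab; rewrite cross_polyE.
move=> [g1 g2]; split; apply/prodf_neq0.
  by move=> a _; rewrite line_polyE.
by move=> [a b] /= ab; rewrite cross_polyE; exact: g2.
Qed.

End Line.

Lemma chart_normal s t x a : chart s t x -> transversal (moment s) (place x a).
Proof. by case. Qed.

(** The normals of the two configurations, scaled by [moment s], span a complex line of
    families of vectors; leaving one of the charts is a polynomial condition on the
    parameter of the line which fails at both ends. *)
Lemma chart_link s t s' t' x y :
  chart s t x -> chart s' t' x -> chart s t y -> chart s' t' y ->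
  exists q : {path (unitI R) from x to y in X},
    forall r, chart s t (q r) /\ chart s' t' (q r).
Proof.
move=> xU xU' yU yU'.
pose v a := normal (moment s) (place x a).
pose w a := normal (moment s) (place y a).
have v1 a : pairing (moment s) (v a) = 1 by apply: pairing_normal; case: xU.
have w1 a : pairing (moment s) (w a) = 1 by apply: pairing_normal; case: yU.
have l1 z a : pairing (moment s) (line v w z a) = 1.
  exact: (pairing_line1 z (v1 a) (w1 a)).
have vx a : annihilates (v a) (place x a) by exact: normal_annihilates.
have wy a : annihilates (w a) (place y a) by exact: normal_annihilates.
have v0 a : v a != 0 by exact: pairing1_neq0 (v1 a).
have w0 a : w a != 0 by exact: pairing1_neq0 (w1 a).
pose p := generic_poly v w s t * generic_poly v w s' t'.
have p0 : p.[0] != 0.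
  apply/horner_mul_neq0; split; apply/generic_polyP; rewrite line0.
    exact/(chartE s t v0 vx).
  exact/(chartE s' t' v0 vx).
have p1 : p.[1] != 0.
  apply/horner_mul_neq0; split; apply/generic_polyP; rewrite line1.
    exact/(chartE s t w0 wy).
  exact/(chartE s' t' w0 wy).
have [g [cg g0 g1 pg]] := avoiding_path p0 p1.
have gen r : generic s t (line v w (g r)) /\ generic s' t' (line v w (g r)).
  have /horner_mul_neq0[a1 a2] := pg r.
  by split; [exact: (generic_polyP v w s t (g r)).1 a1
            |exact: (generic_polyP v w s' t' (g r)).1 a2].
pose F r a := perp s (line v w (g r) a).
have Finj r : injective (F r).
  by have [gr _] := gen r; exact: generic_perp_inj gr.
have Fc a : continuous (F ^~ a).
  move=> r; apply: (@continuous_comp _ _ _ (fun r => line v w (g r) a) (perp s)).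
    apply: cts_addmx; first exact: cts_cst.
    by apply: cts_scalemx; [exact: cg|exact: cts_cst].
  exact: perp_continuous.
have [q cq qF] := config_family x Finj Fc.
have q0 : q zero = x.
  apply: place_eq => a; rewrite qF /F g0 line0 /v normalK//.
  by case: xU.
have q1 : q one = y.
  apply: place_eq => a; rewrite qF /F g1 line1 /w normalK//.
  by case: yU.
exists (mk_path cq q0 q1) => r.
have [gr gr'] := gen r.
have u0 a : line v w (g r) a != 0 by exact: pairing1_neq0 (l1 _ _).
have uq a : annihilates (line v w (g r) a) (place (q r) a).
  by rewrite qF; apply: annihilates_perp; exact: l1.
by split; [exact/(chartE s t u0 uq)|exact/(chartE s' t' u0 uq)].
Qed.

End Charts.

(** * Charts are contractible in the configuration space *)

Section Contraction.
Context {R : realType} {h i k : nat}.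
Local Notation C := (R[i]^o).
Local Notation row := 'rV[C]_k.+1.
Local Notation col := 'cV[C]_k.+1.
Local Notation G := (Gr R k k.+1).
Local Notation X := (config_dim R h i k k.+1).
Implicit Types (x y : X) (a b : 'I_h) (s t : C).

(** Two linear conditions on a space of dimension at least 3. *)
Lemma common_kernel (f g : row) : (2 <= k)%N ->
  exists e : col, [/\ e != 0, pairing f e = 0 & pairing g e = 0].
Proof.
move=> k2; pose A : 'M[C]_(1 + 1, k.+1) := col_mx f g; pose K := kermx A^T.
have K0 : nz_row K != 0.
  rewrite nz_row_eq0 -mxrank_eq0 mxrank_ker mxrank_tr -lt0n subn_gt0.
  by apply: leq_ltn_trans (rank_leq_row A) _.
have KA : A *m (nz_row K)^T = 0.
  apply: trmx_inj; rewrite trmx_mul trmxK trmx0.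
  by apply/sub_kermxP; exact: nz_row_sub.
exists (nz_row K)^T; split.
- by apply: contra K0 => /eqP/(congr1 trmx); rewrite trmxK trmx0 => /eqP.
- by move: KA; rewrite mul_col_mx => /eqP; rewrite col_mx_eq0 => /andP[/eqP/pairing0P].
- by move: KA; rewrite mul_col_mx => /eqP; rewrite col_mx_eq0 => /andP[_ /eqP/pairing0P].
Qed.

Lemma dual_functional (e : col) : e != 0 -> exists f : row, pairing f e = 1.
Proof.
move=> /pairing_neq0[f fe]; exists ((pairing f e)^-1 *: f).
by rewrite pairingZl mulVf.
Qed.

Section Deformation.
Context (f g c : row) (e p : col).
Hypotheses (fe : pairing f e = 0) (ge : pairing g e = 0).
Hypotheses (ce : pairing c e = 1) (fp : pairing f p = 1).
Hypothesis (cp : pairing c p = 0).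

(** As [al] goes from 0 to 1, the coordinate [c] of [v] along [e] becomes [z]; as [be]
    goes from 0 to 1, the vector moves straight to [p + z *: e]. *)
Definition deform (al be : C) (v : col) (z : C) : col :=
  (1 - be) *: (v + (al * (z - pairing c v)) *: e) + be *: (p + z *: e).

Lemma pairing_deform u (al be : C) v (z : C) : pairing u (deform al be v z) =
  (1 - be) * (pairing u v + al * (z - pairing c v) * pairing u e) +
  be * (pairing u p + z * pairing u e).
Proof. by rewrite /deform pairingDr !pairingZr !pairingDr !pairingZr. Qed.

Lemma deform_normal (al be : C) v z : pairing f v = 1 ->
  pairing f (deform al be v z) = 1.
Proof.
by move=> sv; rewrite pairing_deform fe sv fp !mulr0 !addr0 !mulr1 subrK.
Qed.

(** In the first stage [g] separates the vectors, in the second their coordinates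
    along [e] do. *)
Lemma deform_inj (al be : C) v w (z z' : C) : be = 0 \/ al = 1 ->
  pairing g v != pairing g w -> z != z' ->
  deform al be v z <> deform al be w z'.
Proof.
move=> ab vw zz' vwE; have [be0|be0] := eqVneq be 0.
  have E u : pairing g (deform al be u z) = pairing g u.
    by rewrite pairing_deform ge be0 mulr0 addr0 mul0r addr0 subr0 mul1r.
  have E' u : pairing g (deform al be u z') = pairing g u.
    by rewrite pairing_deform ge be0 mulr0 addr0 mul0r addr0 subr0 mul1r.
  by case/eqP: vw; rewrite -(E v) vwE (E' w).
case: ab => [/eqP|al1]; first by rewrite (negPf be0).
have E u (y : C) : pairing c (deform al be u y) = y.
  rewrite pairing_deform ce cp al1 mul1r mulr1 add0r mulr1 addrC.
  by rewrite (addrC (pairing c u)) subrK -mulrDl addrC subrK mul1r.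
by case/eqP: zz'; rewrite -(E v z) vwE (E w z').
Qed.

Lemma deform_start v z : deform 0 0 v z = v.
Proof. by rewrite /deform mul0r scale0r addr0 subr0 scale1r scale0r addr0. Qed.

Lemma deform_end al v z : deform al 1 v z = p + z *: e.
Proof. by rewrite /deform subrr scale0r add0r scale1r. Qed.

Lemma deform_continuous (W : topologicalType) (al be : W -> C) (v : W -> col)
    z w :
  {for w, continuous al} -> {for w, continuous be} -> {for w, continuous v} ->
  {for w, continuous (fun w => deform (al w) (be w) (v w) z)}.
Proof.
move=> cal cbe cv; apply: cts_addmx; apply: cts_scalemx.
- by apply: ctsD; [exact: cts_cst|apply: ctsN; exact: cbe].
- apply: cts_addmx; first exact: cv.
  apply: cts_scalemx; last exact: cts_cst.
  apply: ctsM; first exact: cal.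
  apply: ctsD; first exact: cts_cst.
  apply: ctsN; apply: (@continuous_comp _ _ _ v (pairing c)); first exact: cv.
  exact: pairing_continuous.
- exact: cbe.
- exact: cts_cst.
Qed.

End Deformation.

Definition early (r : unitI R) : C := ((ival (clampI (2 * ival r)))%:C)%C.
Definition late (r : unitI R) : C := ((ival (clampI (2 * ival r - 1)))%:C)%C.

(** The two stages of the deformation take place one after the other. *)
Lemma early_late r : late r = 0 \/ early r = 1.
Proof.
have [r2|r2] := leP (ival r) 2^-1.
  by left; rewrite /late clampI_le0 ?val_zero//; lra.
by right; rewrite /early clampI_ge1 ?val_one//; lra.
Qed.

Lemma early_continuous : continuous early.
Proof.
move=> r; apply: (@continuous_comp _ _ _ (fun r => ival (clampI (2 * ival r)))
  (fun r : R => (r%:C)%C : C)); last exact: real_complex_continuous.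
apply: val_continuous_comp; apply: half_continuous; exact: val_unitI_continuous.
Qed.

Lemma late_continuous : continuous late.
Proof.
move=> r; apply: (@continuous_comp _ _ _ (fun r => ival (clampI (2 * ival r - 1)))
  (fun r : R => (r%:C)%C : C)); last exact: real_complex_continuous.
apply: val_continuous_comp; apply: half2_continuous; exact: val_unitI_continuous.
Qed.

Lemma early0 : early zero = 0.
Proof. by rewrite /early clampI_le0 ?val_zero//; lra. Qed.
Lemma late0 : late zero = 0.
Proof. by rewrite /late clampI_le0 ?val_zero//; lra. Qed.
Lemma late1 : late one = 1.
Proof. by rewrite /late clampI_ge1 ?val_one//; lra. Qed.

(** The deformation moves both paths to the same constant configuration, and on the
    ends of the paths it depends only on the end. *)
Lemma chart_inessential s t : (2 <= k)%N -> @inessential R X (chart s t).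
Proof.
move=> k2 x y q q' qU q'U.
have [e [e0 se te]] := common_kernel (moment s) (moment t) k2.
have [c ce] := dual_functional e0.
pose p0 : col := delta_mx 0 0.
have sp0 : pairing (moment s) p0 = 1.
  by rewrite /pairing -colE mxE moment0.
pose p : col := p0 + (- pairing c p0) *: e.
have sp : pairing (moment s) p = 1.
  by rewrite /p pairingDr pairingZr se mulr0 addr0.
have cp : pairing c p = 0.
  by rewrite /p pairingDr pairingZr ce mulr1 subrr.
pose z a : C := a%:R.
have zinj a b : a != b -> z a != z b.
  by apply: contraNN; rewrite /z eqr_nat.
pose nu x a := normal (moment s) (place x a).
pose F (r : {path (unitI R) from x to y in X}) (w : unitI R * unitI R) a :=
  perp s (deform c e p (early w.2) (late w.2) (nu (r w.1) a) (z a)).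
have family (r : {path (unitI R) from x to y in X}) :
    (forall u, chart s t (r u)) ->
  exists2 K : unitI R * unitI R -> X, continuous K &
    forall w a, place (K w) a = F r w a.
  move=> rU; apply: (config_family x).
    move=> w a b Fab; apply/eqP/contraT => ab.
    have n1 a' : pairing (moment s) (nu (r w.1) a') = 1.
      by apply: pairing_normal; exact: chart_normal (rU _).
    have tab : pairing (moment t) (nu (r w.1) a) !=
               pairing (moment t) (nu (r w.1) b).
      by have [_ rt] := rU w.1; exact: rt.
    have := deform_inj te ce cp (early_late w.2) tab (zinj _ _ ab).
    case.
    have [_ Na] := perpK (deform_normal c se sp (early w.2) (late w.2) (z a) (n1 a)).
    have [_ Nb] := perpK (deform_normal c se sp (early w.2) (late w.2) (z b) (n1 b)).
    exact: etrans (esym Na) (etrans (congr1 (normal (moment s)) Fab) Nb).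
  move=> a w.
  apply: (@continuous_comp _ _ _
    (fun w => deform c e p (early w.2) (late w.2) (nu (r w.1) a) (z a)) (perp s));
    last exact: perp_continuous.
  apply: deform_continuous.
  - apply: (@continuous_comp _ _ _ snd early); first exact: snd_continuous.
    exact: early_continuous.
  - apply: (@continuous_comp _ _ _ snd late); first exact: snd_continuous.
    exact: late_continuous.
  - apply: (@continuous_comp _ _ _ fst (fun u => nu (r u) a)).
      exact: fst_continuous.
    apply: normal_place_continuous; first exact: path_continuous.
    exact: chart_normal (rU _).
have [K cK KE] := family q qU; have [L cL LE] := family q' q'U.
have start (r : {path (unitI R) from x to y in X}) u a :
    (forall u, chart s t (r u)) -> F r (u, zero) a = place (r u) a.
  move=> rU; rewrite /F /= early0 late0 deform_start /nu normalK//.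
  exact: chart_normal (rU _).
have stop r u a : F r (u, one) a = perp s (p + z a *: e).
  by rewrite /F /= late1 deform_end.
(* The sides of the two squares depend only on the common ends of the paths. *)
have side u u' a : q u = q' u -> F q (u, u') a = F q' (u, u') a.
  by rewrite /F /= => ->.
apply: (@contract_homotopic _ _ (K (zero, one)) K L _ _ q q' cK cL).
- by move=> u; apply: place_eq => a; exact: etrans (KE _ a) (start q u a qU).
- by move=> u; apply: place_eq => a; exact: etrans (LE _ a) (start q' u a q'U).
- move=> u; apply: place_eq => a; apply: etrans (KE _ a) _.
  by apply: etrans (stop q u a) _; apply: esym; exact: etrans (KE _ a) (stop q _ a).
- move=> u; apply: place_eq => a; apply: etrans (LE _ a) _.
  by apply: etrans (stop q' u a) _; apply: esym; exact: etrans (KE _ a) (stop q _ a).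
- move=> u; apply: place_eq => a; apply: etrans (KE _ a) _.
  apply: etrans (esym (LE _ a)).
  by apply: side; rewrite [q zero]path_zero [q' zero]path_zero.
- move=> u; apply: place_eq => a; apply: etrans (KE _ a) _.
  apply: etrans (esym (LE _ a)).
  by apply: side; rewrite [q one]path_one [q' one]path_one.
Qed.

End Contraction.

Section Main.
Context {R : realType} {h i k : nat}.
Local Notation X := (config_dim R h i k k.+1).

Lemma config_path_connected (x y : X) :
  exists q : {path (unitI R) from x to y in X}, True.
Proof.
have [s [t [xU yU]]] := common_chart x y.
by have [q _] := chart_link xU xU yU yU; exists q.
Qed.

Lemma config_simply_connected (x : X) : (2 <= k)%N -> trivial_group (pi1 R x).
Proof.
move=> k2; apply: (@pi1_trivial_cover R X (R[i] * R[i])%type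
  (fun st => chart st.1 st.2)).
- by move=> st; exact: chart_open.
- by move=> st; exact: chart_inessential.
- move=> z; have [s [t [xU zU]]] := common_chart x z.
  by exists (s, t); [exact: xU|exact: zU].
- by move=> st st' z xU xU' zU zU'; exact: chart_link.
Qed.

End Main.

(** * Lines in the plane *)

Section ProjectiveLine.
Context {R : realType}.
Local Notation C := (R[i]^o).

Definition gr_line (V : Gr R 1 2) : CP R 1 := (V : subspaces R 1 2).
Definition line_gr (L : CP R 1) : Gr R 1 2 := (L : lines R 1).

Lemma gr_lineK : cancel gr_line line_gr. Proof. by []. Qed.
Lemma line_grK : cancel line_gr gr_line. Proof. by []. Qed.

(** The two quotient maps agree, on matrices with one row. *)
Lemma row_span_vline (v : 'rV[C]_2) : row_span v = <[v]>%VS.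
Proof.
apply/vspaceP => u; rewrite mem_row_span.
by apply/sub_rVP/vlineP.
Qed.

Lemma gr_line_continuous : continuous gr_line.
Proof.
apply/quotient_continuous.
have nz (A : set_type (@full_rank R 1 2)) : \val A \in @nonzero R 1.
  apply/mem_set; have /set_mem := valP A; rewrite /full_rank /nonzero /= => fA.
  by rewrite -mxrank_eq0 (eqP fA).
pose n (A : set_type (@full_rank R 1 2)) : set_type (@nonzero R 1) :=
  exist (fun v => v \in @nonzero R 1) _ (nz A).
have cn : continuous n.
  apply/continuous_comp_initial.
  have -> : set_val \o n = set_val by exact/funext.
  exact: initial_continuous.
have -> : gr_line \o \pi_(Gr R 1 2)%qT = \pi_(CP R 1)%qT \o n.
  apply/funext => A; apply: (@val_inj _ _ {L : {vspace 'rV[C]_2} | \dim L == 1%N}).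
  by rewrite /= !unlock; exact: row_span_vline.
by move=> A; apply: continuous_comp; [exact: cn|exact: pi_continuous].
Qed.

Lemma line_gr_continuous : continuous line_gr.
Proof.
apply/quotient_continuous.
have fr (v : set_type (@nonzero R 1)) : \val v \in @full_rank R 1 2.
  apply/mem_set; have /set_mem := valP v; rewrite /full_rank /nonzero /= => v0.
  by rewrite /row_free eqn_leq rank_leq_row lt0n mxrank_eq0.
pose n (v : set_type (@nonzero R 1)) : set_type (@full_rank R 1 2) :=
  exist (fun A => A \in @full_rank R 1 2) _ (fr v).
have cn : continuous n.
  apply/continuous_comp_initial.
  have -> : set_val \o n = set_val by exact/funext.
  exact: initial_continuous.
have -> : line_gr \o \pi_(CP R 1)%qT = \pi_(Gr R 1 2)%qT \o n.
  apply/funext => A; apply: (@val_inj _ _ {L : {vspace 'rV[C]_2} | \dim L == 1%N}).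
  by rewrite /= !unlock; apply: esym; exact: row_span_vline.
by move=> A; apply: continuous_comp; [exact: cn|exact: pi_continuous].
Qed.

Section Config.
Context {h i : nat}.
Local Notation X := (config_dim R h i 1 2).
Local Notation Y := (config h (CP R 1)).
Implicit Types (x : X) (y : Y).

Definition cp_place y (a : 'I_h) : CP R 1 := \val y a.

Lemma cp_place_inj y : injective (cp_place y).
Proof. by rewrite /cp_place; case: y => y /= /set_mem. Qed.

Lemma cp_place_continuous a : continuous (cp_place ^~ a).
Proof.
move=> y; apply: (@continuous_comp _ _ _ (fun y : Y => \val y)
  (fun p : prod_topology (fun _ : 'I_h => CP R 1) => p a)).
  exact: initial_continuous.
exact: (@proj_continuous _ (fun _ : 'I_h => CP R 1) a).
Qed.

(** The homeomorphism is the identity on lines; path connectedness takes care of the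
    base points. *)
Lemma isomorphic_pi1_line x y : isomorphic_groups (pi1 R x) (pi1 R y).
Proof.
have finj x' : injective (fun a => gr_line (place x' a)).
  by move=> a b /(can_inj gr_lineK)/place_inj.
pose f x' : Y := exist _ ((fun a => gr_line (place x' a)) :
  prod_topology (fun _ : 'I_h => CP R 1)) (mem_set (finj x')).
have cf : continuous f.
  apply/continuous_comp_initial; apply: ptws_continuous => a x'.
  apply: (@continuous_comp _ _ _ (place ^~ a) gr_line).
    exact: place_continuous.
  exact: gr_line_continuous.
have ginj y' : injective (fun a => line_gr (cp_place y' a)).
  by move=> a b /(can_inj line_grK)/cp_place_inj.
have gc a : continuous (fun y' => line_gr (cp_place y' a)).
  move=> y'; apply: (@continuous_comp _ _ _ (cp_place ^~ a) line_gr).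
    exact: cp_place_continuous.
  exact: line_gr_continuous.
have [g cg gE] := config_family x ginj gc.
have fK : cancel f g by move=> x'; apply: place_eq => a; rewrite gE.
have gK : cancel g f.
  move=> y'; apply: val_inj; apply/funext => a.
  by rewrite -[LHS]/(gr_line (place (g y') a)) gE.
have [q _] := config_path_connected x (g y).
apply: isomorphic_groups_trans (isomorphic_pi1_path q) _.
by have := isomorphic_pi1_homeo (g y) cf cg fK gK; rewrite gK.
Qed.

End Config.
End ProjectiveLine.

(** * The theorem *)

Local Close Scope ring_scope.

Theorem mainTheorem4 (R : realType) (n h i : nat)
    (hn : (2 <= n)%N) (hh : (1 <= h)%N)
    (hne : [set: config_dim R h i n.-1 n] !=set0) :
  (n <> 2 ->
    forall x : config_dim R h i n.-1 n, trivial_group (pi1 R x)) /\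
  (n = 2 ->
    forall (x : config_dim R h i n.-1 n) (y : config h (CP R 1)),
      isomorphic_groups (pi1 R x) (pure_braid_group R y)).
Proof.
split=> [n2|n2].
  case: n hn n2 hne => [|[|[|k]]]// _ _ _ x.
  exact: config_simply_connected.
by subst n => x y; exact: isomorphic_pi1_line.
Qed.
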